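(* Suppose Assumptions A1, A2 and A3 hold, with $p\ge 1$ the constant from A3. Then the limit defining $\mathcal L_\Phi^p$ exists, and the following statements are equivalent: (a) $\mathcal L_\Phi^p<0$. (b) A Markov solution exists in $\mathcal H_p$. (c) A unique Markov solution exists in $\mathcal H_p$. (d) There exists $h\in\mathcal H_p$ such that $T^n h$ converges in $L_p(\pi)$-norm, as $n\to\infty$, to some limit in $\mathcal H_p$. (e) A unique Markov solution $h^*$ exists in $\mathcal H_p$, and $T^n h\to h^*$ in $L_p(\pi)$-norm for every $h\in\mathcal H_p$. Moreover, if (a)–(e) hold, the unique Markov solution satisfies $$h^*(x)=\sum_{n=1}^\infty \mathbb E_x\Big[\Big(\prod_{i=1}^n\Phi_i\Big)G_n\Big]\quad\text{for (}\pi\text{-almost) all } x\in\mathsf X.$$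
   Context: Standing setting: $\mathsf X$ and $\mathsf W$ are separable, completely metrizable topological spaces with their Borel $\sigma$-algebras. On a probability space $(\Omega,\mathscr F,\mathbb P)$, $\{X_t\}_{t\ge0}$ is a stationary Markov process on $\mathsf X$ with transition kernel $\Pi$ and stationary marginal distribution $\pi$; $\Pi^n$ is the $n$-step kernel ($\Pi^1=\Pi$, $\Pi^n(x,B)=\int\Pi^{n-1}(x,dz)\Pi(z,B)$). $\{\eta_t\}_{t\ge1}$ is an iid $\mathsf W$-valued sequence with common law $\nu$, independent of $\{X_t\}$. $\phi,g:\mathsf X\times\mathsf X\times\mathsf W\to[0,\infty)$ are Borel measurable and $\Phi_{t+1}=\phi(X_t,X_{t+1},\eta_{t+1})$, $G_{t+1}=g(X_t,X_{t+1},\eta_{t+1})$ for $t\ge0$. $\mathbb E_x$ denotes expectation conditional on $X_0=x$, $\mathbb E$ the unconditional expectation (so $X_0\sim\pi$), and $\mathbb E_t$ conditional expectation given information at time $t$. For $p\ge1$, $L_p(\pi)$ is the Banach lattice of Borel functions $h:\mathsf X\to\mathbb R$ with $\|h\|_p=(\int|h|^p d\pi)^{1/p}<\infty$ (functions equal $\pi$-a.e. identified, order $\pi$-a.e.), and $\mathcal H_p$ is the set of its nonnegative elements. Valuation operator: $Vh(x)=\int h(y)\big[\int\phi(x,y,\eta)\nu(d\eta)\big]\Pi(x,dy)$. Define $\hat g(x)=\int\int\phi(x,y,\eta)g(x,y,\eta)\nu(d\eta)\Pi(x,dy)$ and the operator $Th=Vh+\hat g$. A Markov solution in $\mathcal H_p$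 is an $h\in\mathcal H_p$ with $h=Th$ ($\pi$-a.e.); equivalently $Y_t=h(X_t)$ satisfies $Y_t=\mathbb E_t[\Phi_{t+1}(Y_{t+1}+G_{t+1})]$ for all $t\ge0$. Assumption A1: $\phi>0$ everywhere (so each $\Phi_t>0$), and $G_t>0$ on a set of positive probability. Assumption A2 (irreducibility): for every Borel $B\subset\mathsf X$ with $\pi(B)>0$ and every $x\in\mathsf X$ there is $n\in\mathbb N$ with $\Pi^n(x,B)>0$. Assumption A3: there is $p\ge1$ such that $\hat g\in\mathcal H_p$ and $V$ is a (bounded) linear map from $L_p(\pi)$ to itself which is eventually compact, i.e. some power $V^i$ is a compact operator on $L_p(\pi)$. $p$-th order stability exponent: $\mathcal L_\Phi^p:=\lim_{n\to\infty}\frac{1}{np}\ln\int\Big(\mathbb E_x\prod_{t=1}^n\Phi_t\Big)^p\pi(dx)$; write $\mathcal L_\Phi:=\mathcal L_\Phi^1=\lim_{n}\frac1n\ln\mathbb E\prod_{t=1}^n\Phi_t$. *)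

(* Defs.v *)
From HB Require Import structures.
From mathcomp Require Import all_boot all_order all_algebra.
From mathcomp Require Import all_classical all_reals all_analysis.
Set Implicit Arguments.
Unset Strict Implicit.
Unset Printing Implicit Defensive.
Import Order.TTheory GRing.Theory Num.Theory.
Import numFieldNormedType.Exports.
Local Open Scope classical_set_scope.
Local Open Scope ring_scope.

Definition polish_borel (R : realType) d (T : measurableType d) : Prop :=
  exists dist : T -> T -> R,
    [/\ (forall x y, 0 <= dist x y) /\
        (forall x y, dist x y = 0 <-> x = y) /\
        (forall x y, dist x y = dist y x) /\
        (forall x y z, dist x z <= dist x y + dist y z),
        (forall u : nat -> T,
           (forall e : R, 0 < e -> exists N, forall m n, (N <= m)%N -> (N <= n)%N ->
              dist (u m) (u n) < e) ->
           exists l, forall e : R, 0 < e -> exists N, forall n, (N <= n)%N ->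
              dist (u n) l < e),
        (exists D : set T, countable D /\
           forall x (e : R), 0 < e -> exists y, D y /\ dist x y < e) &
        (@measurable d T =
           <<s [set A : set T | forall x, A x ->
                  exists2 e : R, 0 < e & [set y | dist x y < e] `<=` A] >>)].

Definition scons (A : Type) (a : A) (s : nat -> A) : nat -> A :=
  fun n => if n is k.+1 then s k else a.

Section model.
Context (R : realType) d1 d2 (X : measurableType d1) (W : measurableType d2).
Variables (Pi : R.-pker X ~> X) (pi : probability X R) (nu : probability W R).
Variables (phi g : X -> X -> W -> R).

Local Open Scope ereal_scope.

Definition stationary : Prop :=
  forall B : set X, measurable B -> \int[pi]_x (Pi x B) = pi B.

Fixpoint kpow (n : nat) (x : X) (B : set X) : \bar R :=
  match n with
  | 0 => (\1_B x)%:E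
  | n'.+1 => \int[Pi x]_z kpow n' z B
  end.

(* Canonical (path-space) expectation E_x[F(X_0,X_1,...,eta_1,eta_2,...)]
   for a functional F depending only on X_0..X_n and eta_1..eta_n, where
   X_0 = x, X_{t+1} ~ Pi(X_t, .) and eta_t iid ~ nu independent of X.
   In F xs es, (xs t) stands for X_t and (es t) for eta_{t+1}. *)
Fixpoint pathE (n : nat) (x : X)
    (F : (nat -> X) -> (nat -> W) -> \bar R) : \bar R :=
  match n with
  | 0 => F (fun _ => x) (fun _ => point)
  | n'.+1 => \int[Pi x]_y \int[nu]_e
               pathE n' y (fun xs es => F (scons x xs) (scons e es))
  end.

(* prod_{t=1}^n Phi_t, with Phi_{t+1} = phi(X_t, X_{t+1}, eta_{t+1}) *)
Definition prodPhi (n : nat) (xs : nat -> X) (es : nat -> W) : R :=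
  (\prod_(t < n) phi (xs t) (xs t.+1) (es t))%R.

Definition EprodPhi (n : nat) (x : X) : \bar R :=
  pathE n x (fun xs es => (prodPhi n xs es)%:E).

(* E_x [ (prod_{i=1}^n Phi_i) G_n ],  G_n = g(X_{n-1}, X_n, eta_n) *)
Definition sol_term (n : nat) (x : X) : \bar R :=
  pathE n x (fun xs es =>
    (prodPhi n xs es * g (xs n.-1) (xs n) (es n.-1))%:E).

Definition stab_seq (p : R) (n : nat) : \bar R :=
  lne (\int[pi]_x (EprodPhi n x `^ p)) * ((n%:R * p)^-1)%:E.

Definition phibar (x y : X) : \bar R := \int[nu]_e (phi x y e)%:E.

Definition VE (h : X -> R) (x : X) : \bar R :=
  \int[Pi x]_y ((h y)%:E * phibar x y).
Definition Vop (h : X -> R) : X -> R := fun x => fine (VE h x).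

Definition ghatE (x : X) : \bar R :=
  \int[Pi x]_y \int[nu]_e (phi x y e * g x y e)%:E.
Definition ghat : X -> R := fun x => fine (ghatE x).

Definition Top (h : X -> R) : X -> R := fun x => (Vop h x + ghat x)%R.

Definition inLp (p : R) (h : X -> R) : Prop := h \in Lfun pi p%:E.
Definition inHp (p : R) (h : X -> R) : Prop :=
  inLp p h /\ \forall x \ae pi, (0 <= h x)%R.

Definition Lp_cvg (p : R) (u : nat -> X -> R) (f : X -> R) : Prop :=
  Lnorm pi p%:E (fun x => (u n x - f x)%:E) @[n --> \oo] --> 0.

Definition compact_op (p : R) (A : (X -> R) -> (X -> R)) : Prop :=
  forall hs : nat -> X -> R, (forall k, inLp p (hs k)) ->
    (exists M : R, forall k, Lnorm pi p%:E (EFin \o hs k) <= M%:E) ->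
    exists (sub : nat -> nat) (f : X -> R),
      [/\ {homo sub : m n / (m < n)%N >-> (m < n)%N}, inLp p f &
          Lp_cvg p (fun k => A (hs (sub k))) f].

Definition markov_solution (p : R) (h : X -> R) : Prop :=
  inHp p h /\ h = Top h %[ae pi].

Definition assumption_A1 : Prop :=
  (forall x y e, (0 < phi x y e)%R) /\
  0 < \int[pi]_x pathE 1 x (fun xs es =>
        (if (0 < g (xs 0%N) (xs 1%N) (es 0%N))%R then 1 else 0)%:E).

Definition assumption_A2 : Prop :=
  forall B : set X, measurable B -> 0 < pi B ->
    forall x, exists n, 0 < kpow n.+1 x B.

Definition assumption_A3 (p : R) : Prop :=
  [/\ (1 <= p)%R,
      (\forall x \ae pi, ghatE x < +oo) /\ inHp p ghat,
      (forall h, inLp p h ->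
         (\forall x \ae pi, (Pi x).-integrable setT
                                (fun y => (h y)%:E * phibar x y))
         /\ inLp p (Vop h)),
      (exists C : R, forall h, inLp p h ->
         Lnorm pi p%:E (EFin \o Vop h) <= C%:E * Lnorm pi p%:E (EFin \o h)) &
      (exists i, compact_op p (iter i Vop))].

End model.

(* Main.v *)
Require Import Defs.
From HB Require Import structures.
From mathcomp Require Import all_boot all_order all_algebra.
From mathcomp Require Import all_classical all_reals all_analysis.
From mathcomp Require Import measurable_realfun ring lra.
Set Implicit Arguments.
Unset Strict Implicit.
Unset Printing Implicit Defensive.
Import Order.TTheory GRing.Theory Num.Theory.
Import numFieldNormedType.Exports.
Local Open Scope classical_set_scope.
Local Open Scope ring_scope.

(* Write [V] for the valuation operator, [a_n = |V^n 1|_p] and [b_n] for the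
   operator norm of [V^n].  The crux is an inequality that replaces both the
   Krein-Rutman theorem and duality: if some [V^i] is compact and [s > 0] a.e. in
   [L_p], then for every [e > 0] there is [m] with
       [b_(n+i) <= m |V^n s|_p + e b_n] for all [n],
   because the part of [|V^i f|] exceeding [m s] has norm at most [e] uniformly
   over the unit ball.
   - With [s = 1], iterating it shows that [a_n^(1/n)] and [b_n^(1/n)] have the
     same limit [r], the spectral radius; so the stability exponent is [ln r].
   - If [r < 1], then [|V^n|] decays geometrically, the partial sums of
     [sum_k V^k ghat] converge, and [T^n h = V^n h + sum_(k<n) V^k ghat].
   - If a solution [f] exists, it dominates these partial sums, whose limit [s] is
     again a solution; [s > 0] by irreducibility and [V^n s = sum_(k>=n) V^k ghat]
     tends to [0], so the inequality with [e = 1/2] makes some [b_n < 1]. *)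

(** * Real-valued functions in L_p of a probability *)

Section Lp_space.
Context (R : realType) (d : measure_display) (X : measurableType d).
Context (mu : probability X R) (p : R) (p1 : 1 <= p).
Implicit Types (f g h : X -> R) (u : nat -> X -> R).

(** [fine] sends an infinite norm to 0, so this number is the L_p norm only for functions in
    [inLp]. *)
Definition nrm f : R := fine (Lnorm mu p%:E (EFin \o f)).

Let p0 : 0 < p. Proof. exact: lt_le_trans ltr01 p1. Qed.
Let pE1 : (1 <= p%:E)%E. Proof. by rewrite lee_fin. Qed.

Lemma inLpP f : inLp mu p f <->
  measurable_fun setT f /\ (Lnorm mu p%:E (EFin \o f) < +oo)%E.
Proof.
rewrite /inLp inE; split.
  by case/andP => /[!inE] /= mf ff.
by case=> mf ff; apply/andP; rewrite !inE.
Qed.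

Lemma inLp_meas f : inLp mu p f -> measurable_fun setT f.
Proof. by case/inLpP. Qed.

Lemma nrm_ge0 f : 0 <= nrm f.
Proof. by rewrite fine_ge0// Lnorm_ge0. Qed.

Lemma nrmE f : inLp mu p f -> Lnorm mu p%:E (EFin \o f) = (nrm f)%:E.
Proof.
case/inLpP => mf ff; rewrite fineK// ge0_fin_numE//; exact: Lnorm_ge0.
Qed.

Lemma inLpD f g : inLp mu p f -> inLp mu p g -> inLp mu p (f + g).
Proof.
by move=> lf lg; rewrite /inLp rpredD.
Qed.

Lemma inLpZ f c : inLp mu p f -> inLp mu p (c *: f).
Proof. by move=> lf; rewrite /inLp rpredZ. Qed.

Lemma inLpB f g : inLp mu p f -> inLp mu p g -> inLp mu p (f - g).
Proof. by move=> lf lg; rewrite /inLp rpredB. Qed.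

Lemma inLp0 : inLp mu p 0.
Proof. by rewrite /inLp rpred0. Qed.

Lemma inLp_sum u n : (forall k, inLp mu p (u k)) -> inLp mu p (\sum_(k < n) u k).
Proof. by move=> lu; rewrite /inLp rpred_sum// => k _; apply: lu. Qed.

Lemma inLp_cst c : inLp mu p (cst c).
Proof. exact: Lfun_cst. Qed.

Lemma ler_nrmD f g : inLp mu p f -> inLp mu p g -> nrm (f + g) <= nrm f + nrm g.
Proof.
move=> lf lg; rewrite -lee_fin EFinD -!nrmE//; last exact: inLpD.
by apply: minkowski_EFin => //; exact: inLp_meas.
Qed.

Lemma nrmZ c f : inLp mu p f -> nrm (c *: f) = `|c| * nrm f.
Proof.
move=> lf.
have E : Lnorm mu p%:E (EFin \o (c *: f)) = (`|c|%:E * Lnorm mu p%:E (EFin \o f))%E.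
  exact: (@LnormZ _ _ _ mu p%:E pE1 (Lfun_Sub pE1 lf) c).
by move: E; rewrite (nrmE lf) (nrmE (inLpZ c lf)) -EFinM => -[].
Qed.

Lemma nrm_cst1 : nrm (cst 1) = 1.
Proof.
rewrite /nrm (_ : EFin \o cst 1 = cst 1%E)//.
have mu1 : mu setT = 1%E by exact: probability_setT.
by rewrite Lnorm_cst1 [X in (X `^ _)%E]mu1 poweR_EFin powR1.
Qed.

Lemma Lnorm_powE f : (Lnorm mu p%:E (EFin \o f) `^ p =
  \int[mu]_x (`|f x| `^ p)%:E)%E.
Proof.
by rewrite powR_Lnorm ?gt_eqF//; apply: eq_integral => x _ /=; rewrite poweR_EFin.
Qed.

Lemma nrm_powE f : inLp mu p f ->
  ((nrm f `^ p)%:E = \int[mu]_x (`|f x| `^ p)%:E)%E.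
Proof. by move=> lf; rewrite -Lnorm_powE nrmE// poweR_EFin. Qed.

Lemma measurable_abs_powR f : measurable_fun setT f ->
  measurable_fun setT (fun x => (`|f x| `^ p)%:E).
Proof.
move=> mf; apply/measurable_EFinP.
apply: (measurableT_comp (measurable_powR _)) => //.
exact: measurableT_comp.
Qed.

Lemma inLp_int f : measurable_fun setT f ->
  (\int[mu]_x (`|f x| `^ p)%:E < +oo)%E -> inLp mu p f.
Proof.
move=> mf; rewrite -Lnorm_powE => /lty_poweRy H; apply/inLpP; split => //.
by apply: H; rewrite gt_eqF.
Qed.

Lemma integral_powR_le f g : measurable_fun setT f -> measurable_fun setT g ->
  (\forall x \ae mu, `|f x| <= `|g x|) ->
  (\int[mu]_x (`|f x| `^ p)%:E <= \int[mu]_x (`|g x| `^ p)%:E)%E.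
Proof.
move=> mf mg fg; apply: ae_ge0_le_integral => //.
- exact: measurable_abs_powR.
- exact: measurable_abs_powR.
- apply: filterS fg => x fg _; rewrite lee_fin ge0_ler_powR// ?nnegrE//.
  exact: ltW.
Qed.

Lemma inLp_le f g : measurable_fun setT f -> inLp mu p g ->
  (\forall x \ae mu, `|f x| <= `|g x|) -> inLp mu p f.
Proof.
move=> mf lg fg; apply: inLp_int => //.
apply: le_lt_trans (integral_powR_le mf (inLp_meas lg) fg) _.
by rewrite -nrm_powE// ltry.
Qed.

Lemma ler_nrm f g : inLp mu p f -> inLp mu p g ->
  (\forall x \ae mu, `|f x| <= `|g x|) -> nrm f <= nrm g.
Proof.
move=> lf lg fg.
have := integral_powR_le (inLp_meas lf) (inLp_meas lg) fg.
rewrite -!nrm_powE// lee_fin => H; rewrite leNgt; apply/negP => gf.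
by have := gt0_ltr_powR p0 (nrm_ge0 g) (nrm_ge0 f) gf; rewrite ltNge H.
Qed.

Lemma nrm_ae f g : inLp mu p f -> inLp mu p g -> f = g %[ae mu] -> nrm f = nrm g.
Proof.
move=> lf lg fg; apply/eqP; rewrite eq_le.
by apply/andP; split; apply: ler_nrm => //; apply: filterS fg => x /(_ I) ->.
Qed.

Lemma nrm_eq0 f : inLp mu p f -> nrm f = 0 -> f = cst 0 %[ae mu].
Proof.
move=> lf f0; have := nrmE lf; rewrite f0 => /Lnorm_eq0_eq0.
have mf : measurable_fun setT (EFin \o f) by apply/measurable_EFinP; exact: inLp_meas.
move/(_ mf); rewrite lte_fin => /(_ p0).
by apply: filterS => x /(_ I) [] ->.
Qed.

Lemma inLp_abs f : inLp mu p f -> inLp mu p (fun x => `|f x|).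
Proof.
move=> lf; apply: (inLp_le _ lf).
  by apply: measurableT_comp => //; exact: inLp_meas.
by apply: nearW => x; rewrite normr_id.
Qed.

Lemma inLp_max0 f : inLp mu p f -> inLp mu p (fun x => Num.max (f x) 0).
Proof.
move=> lf; apply: (inLp_le _ lf).
  by apply: measurable_maxr => //; exact: inLp_meas.
by apply: nearW => x /=; case: (leP 0 (f x)) => fx; rewrite ?normr0.
Qed.

Lemma nrm_abs f : inLp mu p f -> nrm (fun x => `|f x|) = nrm f.
Proof.
move=> lf; apply/eqP; rewrite eq_le; apply/andP.
by split; apply: ler_nrm => //; (try exact: inLp_abs);
  apply: nearW => x; rewrite normr_id.
Qed.

Lemma nrm_cvg0_int u : (forall n, inLp mu p (u n)) ->
  (\int[mu]_x (`|u n x| `^ p)%:E)%E @[n --> \oo] --> 0%E ->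
  nrm (u n) @[n --> \oo] --> (0:R).
Proof.
move=> lu; under eq_fun do rewrite -nrm_powE//.
move=> /fine_cvgP[_ /= H]; apply/cvgrPdist_lt => e e0.
have ep : 0 < e `^ p by rewrite powR_gt0.
move/cvgrPdist_lt : H => /(_ _ ep); apply: filterS => n.
rewrite /= !sub0r !normrN !ger0_norm ?powR_ge0 ?nrm_ge0// => H.
rewrite ltNge; apply/negP => en.
have : e `^ p <= nrm (u n) `^ p.
  by apply: ge0_ler_powR => //; rewrite ?nnegrE ?nrm_ge0// ltW.
by rewrite leNgt H.
Qed.

Lemma powR_cvg0_seq (v : nat -> R) : (forall n, 0 <= v n) ->
  v n @[n --> \oo] --> (0:R) -> v n `^ p @[n --> \oo] --> (0:R).
Proof.
move=> v0 vc; apply/cvgrPdist_lt => e e0.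
(* Below 1, a power with exponent [p >= 1] is at most its base. *)
have e1 : 0 < Num.min e 1 by rewrite lt_min e0 ltr01.
move/cvgrPdist_lt : vc => /(_ _ e1); apply: filterS => n.
rewrite /= !sub0r !normrN !ger0_norm ?powR_ge0// lt_min => /andP[ve v1].
apply: le_lt_trans ve.
have [->|vn0] := eqVneq (v n) 0; first by rewrite powR0 ?gt_eqF.
have vn : 0 < v n <= 1 by rewrite lt_def vn0 v0 ltW.
exact: ge1r_powR.
Qed.

(** Dominated convergence for [|u n - f| ^ p], with the integrable bound [|g + g| ^ p]. *)
Lemma nrm_dominated u f g : (forall n, inLp mu p (u n)) -> measurable_fun setT f ->
  inLp mu p g ->
  (\forall x \ae mu, forall n, `|u n x| <= g x) ->
  (\forall x \ae mu, u n x @[n --> \oo] --> f x) ->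
  inLp mu p f /\ nrm (u n - f) @[n --> \oo] --> (0:R).
Proof.
move=> lu mf lg ug uf.
have fg : \forall x \ae mu, `|f x| <= g x.
  apply: filterS2 ug uf => x ug /cvg_norm uf.
  rewrite -(cvg_lim _ uf)//; apply: limr_le; first by apply/cvg_ex; eexists; exact: uf.
  by apply: nearW => n; exact: ug.
have lf : inLp mu p f.
  apply: (inLp_le mf lg); apply: filterS fg => x fg.
  exact: le_trans fg (ler_norm _).
split=> //; apply: nrm_cvg0_int => [n|]; first exact: inLpB.
have lg2 := inLpD lg lg.
have [] := @dominated_convergence _ _ _ mu setT measurableT
   (fun n x => (`|u n x - f x| `^ p)%:E) (cst 0%E)
   (fun x => (`|g x + g x| `^ p)%:E).
- move=> n; apply: measurable_abs_powR; apply: measurable_funB => //.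
  exact: inLp_meas.
- exact: measurable_cst.
- apply: filterS uf => x uf _; apply: cvg_EFin; first exact: nearW.
  rewrite /comp /=; apply: powR_cvg0_seq => // .
  have : (u n x - f x) @[n --> \oo] --> (0:R).
    by rewrite -(subrr (f x)); apply: cvgB => //; exact: cvg_cst.
  by move/cvg_norm; rewrite normr0.
- exact: (Lfun_integrable p1 lg2).
- apply: filterS2 ug fg => x ug fg n _.
  rewrite abse_EFin lee_fin ger0_norm ?powR_ge0//.
  apply: ge0_ler_powR; rewrite ?nnegrE// ?(ltW p0)//.
  apply: le_trans (ler_normB _ _) _.
  by apply: le_trans (ler_norm _); apply: lerD.
move=> _ _; rewrite integral_cst// mul0e.
exact: cvg_trans.
Qed.

(** Monotone convergence bounds the integral of the limit [G] of [|u n| ^ p]; then [G ^ (1/p)] is an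
    L_p function dominating the sequence, and [nrm_dominated] applies. *)
Lemma nrm_monotone u (M : R) : (forall n, inLp mu p (u n)) ->
  (forall n x, 0 <= u n x) ->
  (forall x, {homo u^~ x : m n / (m <= n)%N >-> m <= n}) ->
  (forall n, nrm (u n) <= M) ->
  exists s, [/\ inLp mu p s, (forall x, 0 <= s x),
    (\forall x \ae mu, u n x @[n --> \oo] --> s x) &
    nrm (u n - s) @[n --> \oo] --> (0:R)].
Proof.
move=> lu u0 um uM.
pose F n x := (`|u n x| `^ p)%:E.
have mF n : measurable_fun setT (F n) by apply: measurable_abs_powR; exact: inLp_meas.
have F0 n x : setT x -> (0 <= F n x)%E by move=> _; rewrite lee_fin powR_ge0.
have Fm x : setT x -> {homo F^~ x : m n / (m <= n)%N >-> (m <= n)%E}.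
  move=> _ m n mn; rewrite lee_fin; apply: ge0_ler_powR; rewrite ?nnegrE ?(ltW p0)//.
  by rewrite !ger0_norm//; exact: um.
have M0 : 0 <= M by apply: le_trans (uM 0%N); exact: nrm_ge0.
pose G x := limn (F^~ x).
have cF x : cvgn (F^~ x).
  by apply: ereal_nondecreasing_is_cvgn; exact: Fm.
have FG n x : (F n x <= G x)%E.
  rewrite /G (cvg_lim _ (ereal_nondecreasing_cvgn (Fm x I)))//.
  by apply: ereal_sup_ubound; exists n.
have mG : measurable_fun setT G.
  rewrite (_ : G = (fun x => limn_esup (F^~ x))); last first.
    by apply/funext => x; rewrite is_cvg_limn_esupE.
  exact: measurable_fun_limn_esup.
have G0 x : (0 <= G x)%E by apply: le_trans (FG 0%N x); exact: F0.
have iG : (\int[mu]_x G x < +oo)%E.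
  rewrite monotone_convergence//; apply: (@le_lt_trans _ _ (M `^ p)%:E); last exact: ltry.
  apply: lime_le; first apply: ereal_nondecreasing_is_cvgn.
    move=> m n mn; apply: ge0_le_integral => //; try exact: F0.
    by move=> x _; exact: Fm.
  apply: nearW => n; rewrite /F -nrm_powE// lee_fin.
  by apply: ge0_ler_powR; rewrite ?nnegrE ?nrm_ge0// ltW.
have Gfin : \forall x \ae mu, G x \is a fin_num.
  have : mu.-integrable setT G.
    apply/integrableP; split => //.
    by under eq_integral do rewrite gee0_abs//.
  by move/(integrable_ae measurableT); apply: filterS => x; exact.
pose w x : R := fine (G x) `^ p^-1.
have mw : measurable_fun setT w.
  apply: (measurableT_comp (measurable_powR _)) => //.
  exact: measurableT_comp.
have lw : inLp mu p w.
  apply: inLp_int => //; apply: le_lt_trans iG.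
  apply: ge0_le_integral => //.
  - exact: measurable_abs_powR.
  - move=> x _; rewrite ger0_norm ?powR_ge0// /w -powRrM mulVf ?gt_eqF// powRr1 ?fine_ge0//.
    by have := G0 x; case: (G x) => // *; rewrite leey.
have uw : \forall x \ae mu, forall n, `|u n x| <= w x.
  apply: filterS Gfin => x Gf n; have := FG n x.
  rewrite -(fineK Gf) lee_fin => H.
  rewrite /w -[leLHS]powRr1// -[X in _ `^ X](mulfV (lt0r_neq0 p0)) powRrM.
  by apply: ge0_ler_powR; rewrite ?nnegrE ?powR_ge0// ?invr_ge0 ?(ltW p0)// fine_ge0.
(* The upper limit is measurable without an exceptional set, and it equals the limit almost
   everywhere. *)
pose s x : R := fine (limn_esup (fun n => (u n x)%:E)).
have us : \forall x \ae mu, u n x @[n --> \oo] --> s x.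
  apply: filterS uw => x uw.
  have cu : cvgn (u^~ x).
    apply: nondecreasing_is_cvgn; first exact: um.
    by exists (w x) => _ [n _ <-]; apply: le_trans (ler_norm _) (uw n).
  have cu' : (fun n => (u n x)%:E) @ \oo --> (limn (u^~ x))%:E.
    by apply: cvg_EFin => //; exact: nearW.
  by rewrite /s is_cvg_limn_esupE ?(cvg_lim _ cu')//; apply/cvg_ex; eexists; exact: cu'.
have ms : measurable_fun setT s.
  apply: measurableT_comp => //; apply: measurable_fun_limn_esup => n.
  by apply/measurable_EFinP; exact: inLp_meas.
have [ls cs] := nrm_dominated lu ms lw uw us.
exists s; split => // x; rewrite /s fine_ge0//.
have nu : nondecreasing_seq (fun n => (u n x)%:E).
  by move=> m n mn; rewrite lee_fin; exact: um.
have cu := ereal_nondecreasing_is_cvgn nu.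
rewrite is_cvg_limn_esupE// (cvg_lim _ (ereal_nondecreasing_cvgn nu))//.
by apply: ereal_sup_ge; exists (u 0%N x)%:E; [exists 0%N|rewrite lee_fin].
Qed.

End Lp_space.

(** * Positive operators on L_p *)

Section pointwise.
Context (T : Type) (R : realType).
Implicit Types f g : T -> R.

Lemma addfx f g x : (f + g) x = f x + g x. Proof. by []. Qed.
Lemma subfx f g x : (f - g) x = f x - g x. Proof. by []. Qed.
Lemma scalefx c f x : (c *: f) x = c * f x. Proof. by []. Qed.
Lemma sumfx (u : nat -> T -> R) n x : (\sum_(k < n) u k) x = \sum_(k < n) u k x.
Proof. by rewrite fct_sumE. Qed.

End pointwise.

Section positive_operator.
Context (R : realType) (d : measure_display) (X : measurableType d).
Context (mu : probability X R) (p : R) (p1 : 1 <= p).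
Implicit Types (f g h : X -> R) (A B : (X -> R) -> (X -> R)).
Local Notation nrm := (nrm mu p).
Local Notation inLp := (inLp mu p).

(** Linearity holds only almost everywhere because [Vop] takes [fine] of an integral that may
    diverge on a null set; positivity survives [fine] at every point. *)
Record posop A : Prop := PosOp {
  posop_Lp : forall f, inLp f -> inLp (A f);
  posop_bounded : exists2 C, 0 <= C & forall f, inLp f -> nrm (A f) <= C * nrm f;
  posopD : forall f g, inLp f -> inLp g -> A (f + g) = A f + A g %[ae mu];
  posopZ : forall c f, inLp f -> A (c *: f) = c *: A f %[ae mu];
  posop_ge0 : forall f, (forall x, 0 <= f x) -> forall x, 0 <= A f x }.

Section one.
Variables (A : (X -> R) -> (X -> R)) (pA : posop A).

Lemma posopB f g : inLp f -> inLp g -> A (f - g) = A f - A g %[ae mu].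
Proof.
move=> lf lg; rewrite -(scaleN1r g).
have := posopZ pA (-1) lg.
have := posopD pA lf (inLpZ p1 (-1) lg).
apply: filterS2 => x /(_ I) E1 /(_ I) E2 _; rewrite E1.
by rewrite addfx E2 scalefx mulN1r.
Qed.

(** Boundedness gives [nrm (A (f - g)) = 0], so [A] acts on almost-everywhere classes. *)
Lemma posop_ae f g : inLp f -> inLp g -> f = g %[ae mu] -> A f = A g %[ae mu].
Proof.
move=> lf lg fg; have [C C0 bA] := posop_bounded pA.
have lfg := inLpB p1 lf lg.
have E0 : nrm (f - g) = 0.
  have -> : 0 = nrm (0 *: f) by rewrite nrmZ// normr0 mul0r.
  apply: nrm_ae => //; first exact: inLpZ.
  apply: filterS fg => x /(_ I) fg _.
  by rewrite scalefx mul0r subfx fg subrr.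
have : nrm (A (f - g)) = 0.
  apply/eqP; rewrite eq_le nrm_ge0 andbT.
  by apply: le_trans (bA _ lfg) _; rewrite E0 mulr0.
move/(nrm_eq0 p1 (posop_Lp pA lfg)).
apply: filterS2 (posopB lf lg) => x /(_ I) -> /(_ I) /eqP E _.
by apply/eqP; rewrite -subr_eq0.
Qed.

(** [g - f] agrees almost everywhere with its positive part, which is nonnegative everywhere, as
    [posop_ge0] demands. *)
Lemma posop_le f g : inLp f -> inLp g -> (\forall x \ae mu, f x <= g x) ->
  \forall x \ae mu, A f x <= A g x.
Proof.
move=> lf lg fg; have lgf := inLpB p1 lg lf.
have E : (fun x => Num.max ((g - f) x) 0) = g - f %[ae mu].
  apply: filterS fg => x fg _; apply/max_idPl.
  by rewrite subfx subr_ge0.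
have h0 : forall x, 0 <= A (fun x => Num.max ((g - f) x) 0) x.
  by apply: (posop_ge0 pA) => x; rewrite le_max lexx orbT.
apply: filterS2 (posop_ae (inLp_max0 p1 lgf) lgf E) (posopB lg lf).
move=> x /(_ I) E1 /(_ I) E2; have := h0 x.
by rewrite E1 E2 subfx subr_ge0.
Qed.

Lemma posop_abs f : inLp f -> \forall x \ae mu, `|A f x| <= A (fun x => `|f x|) x.
Proof.
move=> lf; have la := inLp_abs p1 lf.
have ln := inLpZ p1 (-1) lf.
have H1 : \forall x \ae mu, A f x <= A (fun x => `|f x|) x.
  by apply: posop_le => //; apply: nearW => x; exact: ler_norm.
have H2 : \forall x \ae mu, A (-1 *: f) x <= A (fun x => `|f x|) x.
  apply: posop_le => //; apply: nearW => x.
  by rewrite scalefx mulN1r -normrN ler_norm.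
apply: filterS3 H1 H2 (posopZ pA (-1) lf) => x H1 H2 /(_ I) E.
rewrite ler_norml H1 andbT lerNl.
by move: H2; rewrite E scalefx mulN1r.
Qed.

Lemma posop_sum (u : nat -> X -> R) n : (forall k, inLp (u k)) ->
  A (\sum_(k < n) u k) = \sum_(k < n) A (u k) %[ae mu].
Proof.
move=> lu; elim: n => [|n IH].
  rewrite !big_ord0; have := posopZ pA 0 (inLp0 mu p1); rewrite scaler0.
  by apply: filterS => x H _; rewrite (H I) scalefx mul0r.
rewrite !big_ord_recr/=.
have := posopD pA (inLp_sum p1 n lu) (lu n).
by apply: filterS2 IH => x /(_ I) E /(_ I) E' _; rewrite E' !addfx E.
Qed.

End one.

Lemma posop_comp A B : posop A -> posop B -> posop (A \o B).
Proof.
move=> pA pB; have [C C0 bA] := posop_bounded pA; have [D D0 bB] := posop_bounded pB.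
split => /=.
- by move=> f lf; exact/(posop_Lp pA)/(posop_Lp pB).
- exists (C * D) => [|f lf]; first exact: mulr_ge0.
  rewrite -mulrA; apply: le_trans (bA _ (posop_Lp pB lf)) _.
  by rewrite ler_wpM2l// bB.
- move=> f g lf lg; have lBf := posop_Lp pB lf; have lBg := posop_Lp pB lg.
  have := posop_ae pA (posop_Lp pB (inLpD p1 lf lg)) (inLpD p1 lBf lBg)
     (posopD pB lf lg).
  by apply: filterS2 (posopD pA lBf lBg) => x /(_ I) <- /(_ I) ->.
- move=> c f lf; have lBf := posop_Lp pB lf.
  have := posop_ae pA (posop_Lp pB (inLpZ p1 c lf)) (inLpZ p1 c lBf)
     (posopZ pB c lf).
  by apply: filterS2 (posopZ pA c lBf) => x /(_ I) <- /(_ I) ->.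
- by move=> f f0; apply: (posop_ge0 pA); exact: (posop_ge0 pB).
Qed.

Lemma posop_iter A n : posop A -> posop (iter n A).
Proof.
move=> pA; elim: n => [|n IH].
  split => //=; first by exists 1 => // f; rewrite mul1r.
    by move=> *; exact: nearW.
  by move=> *; exact: nearW.
exact: (posop_comp pA IH).
Qed.

(** * Operator norms and compactness *)

Definition opbounds A : set R :=
  [set C | 0 <= C /\ forall f, inLp f -> nrm (A f) <= C * nrm f].

Definition opn A : R := inf (opbounds A).

Lemma opn_inf A : posop A -> has_inf (opbounds A).
Proof.
move=> pA; have [C C0 bA] := posop_bounded pA.
by split; [exists C|exists 0 => x []].
Qed.

Lemma opn_ge0 A : posop A -> 0 <= opn A.
Proof.
move=> pA; apply: lb_le_inf; first by have [] := opn_inf pA.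
by move=> x [].
Qed.

Lemma opn_min A C : posop A -> 0 <= C ->
  (forall f, inLp f -> nrm (A f) <= C * nrm f) -> opn A <= C.
Proof. by move=> pA C0 bA; apply: ge_inf => //; have [] := opn_inf pA. Qed.

Lemma opn_le A f : posop A -> inLp f -> nrm (A f) <= opn A * nrm f.
Proof.
move=> pA lf; have [f0|f0] := eqVneq (nrm f) 0.
  have [C C0 bA] := posop_bounded pA.
  by rewrite f0 mulr0; apply: le_trans (bA _ lf) _; rewrite f0 mulr0.
have fp : 0 < nrm f by rewrite lt_def f0 nrm_ge0.
rewrite -ler_pdivrMr//; apply: lb_le_inf; first by have [] := opn_inf pA.
by move=> C [C0 bA]; rewrite ler_pdivrMr// bA.
Qed.

Lemma opn_comp A B : posop A -> posop B -> opn (A \o B) <= opn A * opn B.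
Proof.
move=> pA pB; apply: opn_min; first exact: posop_comp.
  by rewrite mulr_ge0// opn_ge0.
move=> f lf /=; apply: le_trans (opn_le pA (posop_Lp pB lf)) _.
by rewrite -mulrA ler_wpM2l ?opn_ge0// opn_le.
Qed.

Lemma opn_min1 A C : posop A -> 0 <= C ->
  (forall f, inLp f -> nrm f <= 1 -> nrm (A f) <= C) -> opn A <= C.
Proof.
move=> pA C0 bA; apply: opn_min => // f lf.
have [f0|f0] := eqVneq (nrm f) 0.
  have [D D0 bD] := posop_bounded pA.
  by rewrite f0 mulr0; apply: le_trans (bD _ lf) _; rewrite f0 mulr0.
have fp : 0 < nrm f by rewrite lt_def f0 nrm_ge0.
have l1 := inLpZ p1 (nrm f)^-1 lf.
have n1 : nrm ((nrm f)^-1 *: f) <= 1.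
  by rewrite nrmZ// ger0_norm ?invr_ge0 ?nrm_ge0// mulVf.
have := bA _ l1 n1.
rewrite (nrm_ae p1 _ _ (posopZ pA _ lf)); last 2 first.
- exact: posop_Lp.
- by apply: inLpZ => //; exact: posop_Lp.
rewrite nrmZ//; last exact: posop_Lp.
by rewrite ger0_norm ?invr_ge0 ?nrm_ge0// mulrC ler_pdivrMr.
Qed.

Lemma Lp_cvgE (u : nat -> X -> R) f : (forall n, inLp (u n)) -> inLp f ->
  Lp_cvg mu p u f <-> nrm (u n - f) @[n --> \oo] --> (0:R).
Proof.
move=> lu lf; rewrite /Lp_cvg.
rewrite (_ : (fun n => _) = fun n => (nrm (u n - f))%:E); last first.
  by apply/funext => n; rewrite -nrmE//; exact: inLpB.
split; first by move/fine_cvgP => [].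
by move=> H; apply: cvg_EFin => //; exact: nearW.
Qed.

(* The compactness argument: a sequence of unit vectors violating the bound has
   an [A]-image converging to some [w], but [(|w| - m s)^+] tends to [0]. *)
Lemma compact_almost_dominated A s (e : R) : posop A -> compact_op mu p A ->
  inLp s -> (\forall x \ae mu, 0 < s x) -> 0 < e ->
  exists m : nat, forall f, inLp f -> nrm f <= 1 ->
    nrm (fun x => Num.max (`|A f x| - m%:R * s x) 0) <= e.
Proof.
move=> pA cA ls s0 e0; apply: contrapT => /forallNP H.
have {}H : forall m : nat, exists f, [/\ inLp f, nrm f <= 1 &
    e < nrm (fun x => Num.max (`|A f x| - m%:R * s x) 0)].
  move=> m; have /existsNP[f] := H m.
  move/not_implyP => [lf] /not_implyP[f1 /negP]; rewrite -ltNge => ef.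
  by exists f.
have {}[hs /all_and3[lhs hs1 ehs]] := choice H.
have [|sub [w [subm lw cw]]] := cA hs lhs.
  by exists 1 => k; rewrite nrmE// lee_fin.
have lA k : inLp (A (hs (sub k))) by exact: posop_Lp.
move/(Lp_cvgE lA lw) : cw => cw.
have subge k : (k <= sub k)%N.
  elim: k => // k IH; apply: leq_ltn_trans IH _; exact: subm.
(* [v k] is the excess of [|w|] over [sub k] times [s]; it is dominated by [|w|] and is eventually 0
   wherever [s > 0]. *)
pose v k x := Num.max (`|w x| - (sub k)%:R * s x) 0.
have lv' k : inLp (fun x => `|w x| - (sub k)%:R * s x).
  have := inLpB p1 (inLp_abs p1 lw) (inLpZ p1 (sub k)%:R ls); exact.
have lv k : inLp (v k) by have := inLp_max0 p1 (lv' k); exact.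
have cv : nrm (v k) @[k --> \oo] --> (0:R).
  have [] := @nrm_dominated _ _ _ mu p p1 v (cst 0) (fun x => `|w x|) lv.
  - exact: measurable_cst.
  - exact: inLp_abs.
  - apply: filterS s0 => x s0 n; rewrite ger0_norm; last by rewrite le_max lexx orbT.
    by rewrite ge_max normr_ge0 andbT gerBl mulr_ge0// ltW.
  - apply: filterS s0 => x s0; apply: cvg_near_cst.
    near=> n; apply/max_idPr; rewrite subr_le0 -ler_pdivrMr//.
    apply: (@le_trans _ _ n%:R); last by rewrite ler_nat.
    near: n; exact: nbhs_infty_ger.
  move=> _; rewrite (_ : (fun n => nrm (v n - cst 0)) = fun n => nrm (v n))//.
  by apply/funext => n; congr nrm; rewrite (_ : cst 0 = 0 :> (X -> R)) ?subr0.
have cwv : (nrm (A (hs (sub k)) - w) + nrm (v k)) @[k --> \oo] --> (0:R).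
  by rewrite -(addr0 0); exact: cvgD cw cv.
(* The violation at index [sub N] is refuted by the triangle inequality: the excess of
   [|A (hs (sub N))|] is at most [|A (hs (sub N)) - w| + v N]. *)
move/cvgrPdist_lt : cwv => /(_ _ e0) [N _ /(_ N (leqnn N))].
rewrite /= sub0r normrN; apply/negP; rewrite -leNgt.
apply: le_trans (ler_norm _); apply: le_trans (ltW (ehs (sub N))) _.
have lB := inLp_abs p1 (inLpB p1 (lA N) lw).
rewrite /= -(nrm_abs p1 (inLpB p1 (lA N) lw)); apply: le_trans (ler_nrmD p1 lB (lv N)).
have lA' : inLp (fun x => `|A (hs (sub N)) x| - (sub N)%:R * s x).
  have := inLpB p1 (inLp_abs p1 (lA N)) (inLpZ p1 (sub N)%:R ls); exact.
apply: ler_nrm => //.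
- by have := inLp_max0 p1 lA'; exact.
- exact: inLpD.
apply: nearW => x; rewrite ger0_norm; last by rewrite le_max lexx orbT.
apply: le_trans (ler_norm _).
rewrite addfx subfx /v.
set a := A _ x; set t := _ * s x.
have : `|a| <= `|a - w x| + `|w x| by rewrite -{1}(subrK (w x) a); exact: ler_normD.
have := normr_ge0 (a - w x).
by rewrite ge_max; case: (leP 0 (`|w x| - t)) => h1 h2 h3; apply/andP; split; lra.
Unshelve. all: by end_near.
Qed.

(** For [f] in the unit ball, [|A^i f| <= m s + r] with [nrm r <= e]; the positive operator [A^n]
    preserves this bound, and [m] does not depend on [n]. *)
Lemma opn_compact A s i (e : R) : posop A -> compact_op mu p (iter i A) ->
  inLp s -> (\forall x \ae mu, 0 < s x) -> 0 < e ->
  exists m : nat, forall n, opn (iter (n + i) A) <=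
    m%:R * nrm (iter n A s) + e * opn (iter n A).
Proof.
move=> pA cA ls s0 e0; have pi := posop_iter i pA.
have [m Hm] := compact_almost_dominated pi cA ls s0 e0.
exists m => n; have pn := posop_iter n pA.
apply: opn_min1; first exact: posop_iter.
  by rewrite addr_ge0// mulr_ge0 ?nrm_ge0 ?opn_ge0// ltW.
move=> f lf f1; rewrite iterD.
set g := iter i A f; have lg : inLp g by exact: posop_Lp.
pose r x := Num.max (`|g x| - m%:R * s x) 0.
have lr : inLp r.
  have := inLpB p1 (inLp_abs p1 lg) (inLpZ p1 m%:R ls) => l.
  by have := inLp_max0 p1 l; exact.
have lms := inLpZ p1 m%:R ls.
have lmr := inLpD p1 lms lr.
have H : \forall x \ae mu, `|iter n A g x| <= `|(m%:R *: iter n A s + iter n A r) x|.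
  have H1 : \forall x \ae mu, iter n A (fun x => `|g x|) x <= iter n A (m%:R *: s + r) x.
    apply: posop_le => //; first exact: inLp_abs.
    apply: nearW => x; rewrite addfx /r scalefx.
    by rewrite -lerBlDl le_max lexx.
  have H2 := posopD pn lms lr.
  have H3 := posopZ pn m%:R ls.
  have H4 := posop_abs pn lg.
  apply: filterS2 (filterI H1 H2) (filterI H3 H4) => x [H1x /(_ I) H2x] [/(_ I) H3x H4x].
  apply: le_trans H4x _; apply: le_trans H1x _; rewrite H2x.
  by rewrite addfx H3x; exact: ler_norm.
have ln : inLp (iter n A r) by exact: posop_Lp.
have lns : inLp (iter n A s) by exact: posop_Lp.
apply: le_trans (ler_nrm p1 _ _ H) _; first exact: posop_Lp.
  by apply: inLpD => //; apply: inLpZ.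
apply: le_trans (ler_nrmD p1 (inLpZ p1 _ lns) ln) _.
rewrite nrmZ// ger0_norm// lerD2l.
apply: le_trans (opn_le pn lr) _.
by rewrite mulrC ler_wpM2r ?opn_ge0//; exact: Hm.
Qed.

End positive_operator.

(** * Growth rates of submultiplicative sequences *)

Section growth_rate.
Context (R : realType).
Implicit Types (a b c : nat -> R) (t : R).

(** Bernoulli's inequality [1 + n (t - 1) <= t ^+ n] gives an explicit [N]. *)
Lemma expr_large t (K : R) : 1 < t -> exists N, forall n, (N <= n)%N -> K <= t ^+ n.
Proof.
move=> t1; pose N := (Num.truncn (`|K| / (t - 1))).+1; exists N => n Nn.
have t0 : 0 < t - 1 by rewrite subr_gt0.
have H : 1 + n%:R * (t - 1) <= t ^+ n.
  elim: n {Nn} => [|n IH]; first by rewrite expr0 mul0r addr0.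
  rewrite exprS; apply: (@le_trans _ _ (t * (1 + n%:R * (t - 1)))).
    have : 0 <= n%:R * (t - 1) * (t - 1) by rewrite !mulr_ge0// ltW.
    rewrite -natr1; lra.
  by rewrite ler_wpM2l// ltW// (lt_trans ltr01).
apply: le_trans H; apply: le_trans (ler_norm _) _.
have : `|K| <= n%:R * (t - 1).
  rewrite -ler_pdivrMr//; apply: (@le_trans _ _ N%:R); last by rewrite ler_nat.
  by rewrite ltW// truncnS_gt.
by move=> H; apply: le_trans H _; rewrite lerDr.
Qed.

Definition growth_bounds b : set R :=
  [set t | 0 < t /\ exists2 C, 0 <= C & forall n, b n <= C * t ^+ n].

(** For a submultiplicative nonnegative sequence this is the Fekete limit of [b n ^ (1/n)]; the
    infimum over geometric bounds avoids taking roots. *)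
Definition growth b : R := inf (growth_bounds b).

Section submultiplicative.
Variables (b : nat -> R).
Hypotheses (b0 : forall n, 0 <= b n) (bM : forall m n, b (m + n)%N <= b m * b n).

Lemma growth_has_inf : has_inf (growth_bounds b).
Proof.
split; last by exists 0 => t [/ltW].
have b1 : 0 < b 1%N + 1 by rewrite ltr_wpDl.
exists (b 1%N + 1); split => //.
exists (b 0%N) => // n; elim: n => [|n IH]; first by rewrite expr0 mulr1.
rewrite -addn1; apply: le_trans (bM _ _) _; rewrite addn1 exprSr mulrA.
by apply: ler_pM => //; rewrite lerDl.
Qed.

Lemma growth_ge0 : 0 <= growth b.
Proof.
by apply: lb_le_inf; [have [] := growth_has_inf|move=> t [/ltW]].
Qed.

Lemma growth_bounds_gt t : growth b < t ->
  exists2 C, 0 <= C & forall n, b n <= C * t ^+ n.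
Proof.
move=> bt; have [u [u0 [C C0 bC]] ut] := inf_lt growth_has_inf.1 bt.
exists C => // n; apply: le_trans (bC n) _.
by rewrite ler_wpM2l// lerXn2r ?nnegrE ?(ltW (lt_trans u0 ut)) ?(ltW u0) ?(ltW ut).
Qed.

(** Split an index into blocks of length [n.+1], each costing a factor [t ^+ n.+1]; the sum in the
    constant covers every possible remainder. *)
Lemma growth_le t n : 0 < t -> b n.+1 <= t ^+ n.+1 -> growth b <= t.
Proof.
move=> t0 bn; apply: ge_inf; first by have [] := growth_has_inf.
split => //; exists (\sum_(k < n.+1) b k / t ^+ k).
  by apply: sumr_ge0 => k _; rewrite divr_ge0// exprn_ge0// ltW.
move=> m; have [k] := ubnP m; elim: k m => // k IH m mk.
case: (ltnP m n.+1) => mn.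
  rewrite -ler_pdivrMr ?exprn_gt0// (bigD1 (Ordinal mn))//= lerDl.
  by apply: sumr_ge0 => l _; rewrite divr_ge0// exprn_ge0// ltW.
have mE := esym (subnKC mn).
rewrite [X in b X]mE [X in _ ^+ X]mE exprD mulrCA.
apply: le_trans (bM _ _) _.
apply: ler_pM => //; apply: IH.
apply: (@leq_trans m) => //; rewrite ltn_subrL ltn0Sn /=.
exact: leq_trans mn.
Qed.

(** Otherwise the [n.+1]-th root [t] of the midpoint between [b n.+1] and [growth b ^+ n.+1] would
    satisfy [growth_le], forcing [growth b ^+ n.+1] below that midpoint. *)
Lemma growth_exp_le n : growth b ^+ n.+1 <= b n.+1.
Proof.
rewrite leNgt; apply/negP => bg.
pose t := ((b n.+1 + growth b ^+ n.+1) / 2) `^ (n.+1%:R)^-1.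
have m0 : 0 < (b n.+1 + growth b ^+ n.+1) / 2.
  by rewrite divr_gt0// ltr_wpDl// (le_lt_trans _ bg).
have t0 : 0 < t by rewrite powR_gt0.
have tn : t ^+ n.+1 = (b n.+1 + growth b ^+ n.+1) / 2.
  by rewrite -powR_mulrn ?powR_ge0// /t -powRrM mulVf ?pnatr_eq0// powRr1// ltW.
have gt : growth b <= t.
  apply: (@growth_le t n) => //; rewrite tn; lra.
have : growth b ^+ n.+1 <= t ^+ n.+1.
  by rewrite ler_pXn2r ?nnegrE ?growth_ge0// ltW.
rewrite tn; lra.
Qed.

(** A rate [u] strictly between leaves the factor [(t / u) ^+ n] to absorb the constant. *)
Lemma growth_upper t : growth b < t -> exists N, forall n, (N <= n)%N -> b n <= t ^+ n.
Proof.
move=> bt; pose u := (growth b + t) / 2.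
have [u1 u2] : growth b < u /\ u < t by rewrite /u; split; lra.
have u0 : 0 < u by apply: le_lt_trans u1; exact: growth_ge0.
have [C C0 bC] := growth_bounds_gt u1.
have [|N HN] := @expr_large (t / u) C; first by rewrite ltr_pdivlMr// mul1r.
exists N => n Nn; apply: le_trans (bC n) _.
rewrite -ler_pdivlMr ?exprn_gt0// -expr_div_n; exact: HN.
Qed.

Section lower.
Variables (a : nat -> R) (i : nat).
Hypotheses (a0 : forall n, 0 <= a n)
  (ab : forall n k, a (n + k)%N <= b k * a n)
  (key : forall e, 0 < e -> exists m : nat, forall n, b (n + i)%N <= m%:R * a n + e * b n).

(** Apply [key] [j] times; the shifted terms [a (n + j * i)] that appear are brought back to [a n]
    by [ab] and the bound on [b (j * i)]. *)
Lemma growth_iterate (e : R) : 0 < e -> exists2 D, 1 <= D &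
  forall j n, b (n + j * i)%N <= D ^+ j * a n + e ^+ j * b n.
Proof.
move=> e0; have [m Hm] := key e0.
pose B := 1 + b 0%N + b i.
have B1 : 1 <= B by rewrite /B -addrA lerDl addr_ge0.
have bB j : b (j * i)%N <= B ^+ j.+1.
  elim: j => [|j IH].
    by rewrite mul0n expr1 /B; have := b0 i; lra.
  rewrite mulSn; apply: le_trans (bM _ _) _; rewrite exprS.
  apply: ler_pM => //; rewrite /B; have := b0 0%N; lra.
have mB : 0 <= m%:R * B by rewrite mulr_ge0// (le_trans ler01).
(* [m%:R * B] pays for the new [a] term and [e] for the old one; the summand [B] ensures [B <= D],
   hence [1 <= D]. *)
pose D := m%:R * B + e + B.
have BD : B <= D by rewrite /D lerDr addr_ge0// ltW.
have D1 : 1 <= D by exact: le_trans BD.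
have D0 : 0 <= D by exact: le_trans D1.
exists D => // j n; elim: j => [|j IH].
  by rewrite mul0n addn0 !expr0 !mul1r lerDr.
rewrite mulSn [(i + _)%N]addnC addnA.
apply: le_trans (Hm _) _.
have H1 : m%:R * a (n + j * i)%N <= m%:R * B * D ^+ j * a n.
  rewrite -!mulrA ler_wpM2l//; apply: le_trans (ab _ _) _.
  rewrite mulrA ler_wpM2r//; apply: le_trans (bB j) _.
  rewrite exprS ler_wpM2l//; first exact: le_trans B1.
  by rewrite lerXn2r ?nnegrE// (le_trans ler01).
have H2 : e * b (n + j * i)%N <= e * (D ^+ j * a n + e ^+ j * b n).
  by rewrite ler_wpM2l// ltW.
apply: le_trans (lerD H1 H2) _.
have H3 : 0 <= B * (D ^+ j * a n).
  by rewrite !mulr_ge0 ?exprn_ge0// (le_trans ler01).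
rewrite [D ^+ j.+1]exprS [e ^+ j.+1]exprS {1}/D.
move: H3; move: (D ^+ j) (e ^+ j) (a n) (b n) => x y z w H3.
have -> : (m%:R * B + e + B) * x * z + e * y * w =
  m%:R * B * x * z + e * (x * z + y * w) + B * (x * z) by ring.
by rewrite lerDl.
Qed.

(** With [e = r^i / 4], after [j ~ n / q] iterations the [b n] term is at most half of
    [r^(n + j i) <= b (n + j i)]. Thus [a n >= r^(n + j i) / (2 D^j)], and for large [q] the factor
    [(r^i / D)^j / 2] is absorbed by [(r / t)^n]. *)
Lemma growth_lower t : 0 < t -> t < growth b ->
  exists N, forall n, (N <= n)%N -> t ^+ n <= a n.
Proof.
set r := growth b => t0 tr.
have r0 : 0 < r by exact: lt_trans tr.
have ri0 : 0 < r ^+ i by rewrite exprn_gt0.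
have [|D D1 HD] := @growth_iterate (r ^+ i / 4); first by rewrite divr_gt0.
have D0 : 0 < D by exact: lt_le_trans D1.
(* A lower bound for [r ^+ i / D], the factor incurred per iteration. *)
pose k := r ^+ i / (D + r ^+ i).
have Dri : 0 < D + r ^+ i by rewrite addr_gt0.
have k0 : 0 < k by rewrite divr_gt0.
pose th := r / t.
have th1 : 1 < th by rewrite ltr_pdivlMr// mul1r.
have th0 : 0 < th by exact: lt_trans th1.
(* [th ^+ q] beats [k ^- 2], so that [j] factors [k] cost only about half of the growth
   [th ^+ n]. *)
have [q0 Hq0] := expr_large (k ^- 2) th1.
pose q := q0.+1.
have Hq : k ^- 2 <= th ^+ q by apply: Hq0; exact: leqnSn.
(* [s = 2^(1/q)] turns [b n <= (r * s) ^+ n] into [b n <= r ^+ n * 2 ^+ j], since [n <= j * q]. *)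
pose s : R := 2 `^ (q%:R)^-1.
have sq : s ^+ q = 2.
  by rewrite -powR_mulrn ?powR_ge0// /s -powRrM mulVf ?pnatr_eq0// powRr1.
have s1 : 1 < s.
  rewrite ltNge; apply/negP => s1; have : s ^+ q <= 1 by rewrite exprn_ile1// powR_ge0.
  by rewrite sq; lra.
have s0 : 0 < s by exact: lt_trans s1.
have [|N1 HN1] := @growth_upper (r * s).
  by rewrite -/r -[ltLHS]mulr1 ltr_pM2l.
have [N2 HN2] := expr_large 4 th1.
exists (maxn N1 (N2 + q).+1) => n; rewrite geq_max => /andP[n1 n2].
pose j := (n %/ q).+1.
have jq1 : (n <= j * q)%N by rewrite ltnW// ltn_ceil.
have jq2 : (j * q <= n + q)%N by rewrite mulSn addnC leq_add2r leq_trunc_div.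
have bn : (r ^+ i / 4) ^+ j * b n <= r ^+ (n + j * i) / 2.
  apply: (@le_trans _ _ ((r ^+ i / 4) ^+ j * (r ^+ n * 2 ^+ j))).
    rewrite ler_wpM2l//; first by rewrite exprn_ge0// divr_ge0// ltW.
    apply: le_trans (HN1 n n1) _; rewrite exprMn ler_wpM2l// ?exprn_ge0 ?(ltW r0)//.
    by rewrite -sq -exprM mulnC ler_eXn2l.
  rewrite expr_div_n -exprM exprD mulnC [r ^+ n * r ^+ _]mulrC -!mulrA.
  rewrite ler_wpM2l ?exprn_ge0 ?(ltW r0)// mulrCA ler_wpM2l ?exprn_ge0 ?(ltW r0)//.
  have -> : (4:R) = 2 * 2 by lra.
  rewrite exprMn invfM -mulrA mulVf ?expf_neq0// mulr1.
  rewrite lef_pV2 ?posrE ?exprn_gt0// exprS ler_peMr//.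
  by rewrite exprn_ege1// ler1n.
have rn : r ^+ (n + j * i) <= b (n + j * i)%N.
  have n0 : (0 < n + j * i)%N by rewrite addn_gt0 (leq_trans _ n2).
  by rewrite -(prednK n0); exact: growth_exp_le.
have an : r ^+ (n + j * i) / 2 <= D ^+ j * a n.
  have := HD j n; lra.
have an2 : r ^+ n * k ^+ j / 2 <= a n.
  rewrite /k expr_div_n -exprM mulrA -exprD mulnC.
  rewrite mulrAC ler_pdivrMr ?exprn_gt0// mulrC [leRHS]mulrC.
  rewrite mulrC; apply: le_trans an _; rewrite ler_wpM2r//.
  by rewrite lerXn2r ?nnegrE ?(ltW Dri) ?(ltW D0)// lerDl ltW.
apply: le_trans an2.
(* Compare squares: [2 n = (n - q) + (n + q)], where the first part gives the factor 4 and the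
   second outweighs [k ^+ (j * 2)]. *)
have H4 : 2 <= th ^+ n * k ^+ j.
  have h0 : 0 <= th ^+ n * k ^+ j by rewrite mulr_ge0// exprn_ge0// ltW.
  rewrite -(@ler_pXn2r _ 2%N) ?nnegrE// exprMn -!exprM.
  have qn : (q <= n)%N by apply: leq_trans (ltnW n2); rewrite leq_addl.
  have -> : (n * 2 = (n - q) + (n + q))%N by rewrite addnCA subnK// muln2 addnn.
  rewrite exprD -mulrA.
  have h1 : 4 <= th ^+ (n - q).
    by apply: HN2; rewrite leq_subRL// addnC ltnW.
  have h2 : 1 <= th ^+ (n + q) * k ^+ (j * 2).
    apply: (@le_trans _ _ (th ^+ (j * q) * k ^+ (j * 2))); last first.
      rewrite ler_wpM2r ?exprn_ge0 ?(ltW k0)// ler_eXn2l//.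
    rewrite mulnC exprM [(j * 2)%N]mulnC (exprM k) -exprMn exprn_ege1//.
    by rewrite -ler_pdivrMr ?exprn_gt0// mul1r.
  have -> : (2 : R) ^+ 2 = 4 * 1 by rewrite expr2; lra.
  by apply: ler_pM => //; lra.
have -> : t ^+ n = r ^+ n / th ^+ n.
  by rewrite -expr_div_n /th invf_div mulrCA mulfV ?mulr1// gt_eqF.
rewrite ler_pdivrMr ?exprn_gt0// -!mulrA ler_peMr// ?exprn_ge0 ?(ltW r0)//.
rewrite mulrC -mulrA [_ * k ^+ j]mulrC mulrA.
by move: H4; rewrite mulrC; lra.
Qed.

End lower.

(** Halving along steps of length [i] brings [b] below 1 at a positive index, and [growth_exp_le]
    bounds [growth b] there. *)
Lemma growth_lt1 c i (m : R) : 0 <= m -> c n @[n --> \oo] --> (0:R) ->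
  (forall n, b (n + i)%N <= m * c n + 2^-1 * b n) -> growth b < 1.
Proof.
move=> m0 c0 key.
(* The value 1/8 is chosen so that [y |-> 1/8 + y/2] fixes 1/4, the additive term in [H]. *)
have [N HN] : exists N, forall n, (N <= n)%N -> m * c n <= 8^-1.
  have mc : (m * c n) @[n --> \oo] --> (0:R).
    by rewrite -(mulr0 m); apply: cvgM => //; exact: cvg_cst.
  have e0 : (0:R) < 8^-1 by rewrite invr_gt0.
  move/cvgrPdist_lt : mc => /(_ _ e0) [N _ HN].
  exists N => n Nn; have := HN n Nn; rewrite /= sub0r normrN => h.
  by apply: le_trans (ler_norm _) _; exact: ltW.
(* The successor keeps every index positive for [growth_exp_le]. *)
pose N' := N.+1.
have H j : b (N' + j * i)%N <= 4^-1 + b N' / 2 ^+ j.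
  elim: j => [|j IH].
    by rewrite mul0n addn0 expr0 divr1 lerDr invr_ge0.
  rewrite mulSn addnCA addnC; apply: le_trans (key _) _.
  have := HN (N' + j * i)%N (leq_trans (leqnSn _) (leq_addr _ _)).
  rewrite exprS invfM mulrA [b N' / 2]mulrC -mulrA.
  move: IH; set y := b N' / _; set x := b _; set z := m * _.
  lra.
have [|K HK] := @expr_large 2 (4 * b N'); first by rewrite ltr1n.
have h := H K.
have h2 : b N' / 2 ^+ K <= 4^-1.
  by rewrite ler_pdivrMr ?exprn_gt0// mulrC ler_pdivlMr// mulrC; apply: HK.
have h3 : b (N' + K * i)%N < 1 by lra.
rewrite ltNge; apply/negP => g1.
have := growth_exp_le (N + K * i); rewrite leNgt => /negP; apply.
apply: (@lt_le_trans _ _ 1); first by rewrite -addSn.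
by rewrite exprn_ege1.
Qed.

End submultiplicative.
End growth_rate.

(** * The affine recursion [h |-> A h + gh] *)

Section affine_dynamics.
Context (R : realType) (d : measure_display) (X : measurableType d).
Context (mu : probability X R) (p : R) (p1 : 1 <= p).
Variables (A : (X -> R) -> (X -> R)) (gh : X -> R).
Hypotheses (pA : posop mu p A) (lgh : inLp mu p gh) (gh0 : forall x, 0 <= gh x).
Local Notation nrm := (nrm mu p).
Local Notation inLp := (inLp mu p).
Implicit Types (f h : X -> R).

Let T h : X -> R := A h + gh.
Let S n : X -> R := \sum_(k < n) iter k A gh.

Definition iter_norm n := opn mu p (iter n A).
Definition spectral_radius := growth iter_norm.
Local Notation r := spectral_radius.

Let pn n : posop mu p (iter n A). Proof. exact: posop_iter. Qed.
Let lAg n : inLp (iter n A gh). Proof. exact: posop_Lp. Qed.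
Let lS n : inLp (S n). Proof. exact: inLp_sum. Qed.

Lemma iter_norm_ge0 n : 0 <= iter_norm n.
Proof. exact: opn_ge0. Qed.

Lemma iter_normM m n : iter_norm (m + n) <= iter_norm m * iter_norm n.
Proof.
rewrite /iter_norm (_ : iter (m + n) A = iter m A \o iter n A); last first.
  by apply/funext => f /=; rewrite iterD.
exact: opn_comp.
Qed.

Lemma nrm_iter_geometric : r < 1 -> exists t C, [/\ 0 < t, t < 1, 0 <= C &
  forall f n, inLp f -> nrm (iter n A f) <= C * t ^+ n * nrm f].
Proof.
move=> r1; pose t := (r + 1) / 2.
have r0 : 0 <= r := growth_ge0 iter_norm_ge0 iter_normM.
have [rt t1] : r < t /\ t < 1 by rewrite /t; split; lra.
have [C C0 bC] := growth_bounds_gt iter_norm_ge0 iter_normM rt.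
exists t, C; split => //; first exact: le_lt_trans rt.
move=> f n lf; apply: le_trans (opn_le (pn n) lf) _.
by rewrite ler_wpM2r ?nrm_ge0//; exact: bC.
Qed.

Lemma nrm_iter_cvg0 f : r < 1 -> inLp f -> nrm (iter n A f) @[n --> \oo] --> (0:R).
Proof.
move=> r1 lf; have [t [C [t0 t1 C0 H]]] := nrm_iter_geometric r1.
apply: (@squeeze_cvgr _ _ _ _ (cst 0) (fun n => C * nrm f * t ^+ n)).
- by apply: nearW => n; rewrite nrm_ge0/= mulrAC H.
- exact: cvg_cst.
- rewrite -(mulr0 (C * nrm f)); apply: cvgM; first exact: cvg_cst.
  by apply: cvg_expr; rewrite ger0_norm// ltW.
Qed.

Lemma iterA_ge0 n x : 0 <= iter n A gh x.
Proof. exact: (posop_ge0 (pn n)). Qed.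

Lemma partial_sum_ge0 n x : 0 <= S n x.
Proof. by rewrite /S (sumfx (fun k => iter k A gh)) sumr_ge0// => k _; exact: iterA_ge0. Qed.

Lemma partial_sum_mono x : {homo S^~ x : m n / (m <= n)%N >-> m <= n}.
Proof.
move=> m n mn; rewrite /S !(sumfx (fun k => iter k A gh)).
rewrite -!(big_mkord xpredT (fun k => iter k A gh x)).
by rewrite [leRHS](big_cat_nat (n := m))//= lerDl sumr_ge0// => k _; exact: iterA_ge0.
Qed.

Lemma partial_sum_cvg (M : R) : (forall n, nrm (S n) <= M) ->
  exists s, [/\ inLp s, (forall x, 0 <= s x),
    (\forall x \ae mu, S n x @[n --> \oo] --> s x) &
    nrm (S n - s) @[n --> \oo] --> (0:R)].
Proof.
move=> SM; apply: (nrm_monotone p1 lS) SM; first exact: partial_sum_ge0.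
exact: partial_sum_mono.
Qed.

(** The geometric decay of [A^n gh] sums to at most [C * nrm gh / (1 - t)], a uniform bound on the
    norms of the increasing partial sums. *)
Lemma partial_sum_cvg_lt1 : r < 1 ->
  exists s, [/\ inLp s, (forall x, 0 <= s x),
    (\forall x \ae mu, S n x @[n --> \oo] --> s x) &
    nrm (S n - s) @[n --> \oo] --> (0:R)].
Proof.
move=> r1; have [t [C [t0 t1 C0 H]]] := nrm_iter_geometric r1.
apply: (@partial_sum_cvg (C * nrm gh / (1 - t))) => n.
have t1' : 0 < 1 - t by rewrite subr_gt0.
apply: (@le_trans _ _ (C * nrm gh * ((1 - t ^+ n) / (1 - t)))); last first.
  rewrite -!mulrA ler_wpM2l// ler_wpM2l ?nrm_ge0//.
  by rewrite ler_piMl ?invr_ge0 ?(ltW t1')// gerBl exprn_ge0// ltW.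
elim: n => [|n IH].
  rewrite /S big_ord0 expr0 subrr mul0r mulr0.
  by rewrite -(scale0r (0 : X -> R)) nrmZ ?normr0 ?mul0r//; exact: inLp0.
rewrite /S big_ord_recr/=; apply: le_trans (ler_nrmD p1 (lS n) (lAg n)) _.
apply: le_trans (lerD IH (H _ n lgh)) _.
rewrite [C * t ^+ n * _]mulrAC -mulrDr ler_wpM2l ?mulr_ge0 ?nrm_ge0//.
rewrite -[X in _ + X](mulfK (lt0r_neq0 t1')) -mulrDl ler_wpM2r ?invr_ge0 ?(ltW t1')//.
by rewrite exprSr; lra.
Qed.

Lemma inLp_T h : inLp h -> inLp (T h).
Proof. by move=> lh; apply: inLpD => //; exact: posop_Lp. Qed.

Lemma inLp_iterT h n : inLp h -> inLp (iter n T h).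
Proof. by move=> lh; elim: n => //= n IH; exact: inLp_T. Qed.

Lemma iterTE h n : inLp h -> iter n T h = iter n A h + S n %[ae mu].
Proof.
move=> lh; elim: n => [|n IH].
  by rewrite /S big_ord0 addr0; apply: nearW.
have lAh : inLp (iter n A h) by exact: posop_Lp.
have E1 := posop_ae p1 pA (inLp_iterT n lh) (inLpD p1 lAh (lS n)) IH.
have E2 := posopD pA lAh (lS n).
have E3 := posop_sum p1 pA n lAg.
apply: filterS3 E1 E2 E3 => x /(_ I) E1 /(_ I) E2 /(_ I) E3 _.
rewrite /= /T [LHS]addfx E1 E2 [in RHS]addfx addfx -addrA; congr (_ + _).
(* Peeling the term [k = 0] off [S n.+1] leaves [A (S n)]. *)
rewrite /S big_ord_recl [in RHS]addfx addrC; congr (_ + _).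
by rewrite E3.
Qed.

Lemma iterA0 n : \forall x \ae mu, iter n A 0 x = 0.
Proof.
have := posopZ (pn n) 0 (inLp0 mu p1); rewrite scaler0.
by apply: filterS => x /(_ I) E; apply: etrans E _; rewrite scalefx mul0r.
Qed.

(** [f - T f = - (T^(n+1) h - f) + A (T^n h - f)], and both summands tend to 0 in norm because [A]
    is bounded. *)
Lemma T_limit_fixed h f : inLp h -> inLp f ->
  nrm (iter n T h - f) @[n --> \oo] --> (0:R) -> f = T f %[ae mu].
Proof.
move=> lh lf cv; have [C C0 bA] := posop_bounded pA.
have lu n := inLp_iterT n lh; have lTf := inLp_T lf.
have le n : nrm (f - T f) <= nrm (iter n.+1 T h - f) + C * nrm (iter n T h - f).
  have l1 := inLpB p1 (lu n.+1) lf.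
  have l2 := inLpB p1 (lu n) lf.
  have l3 := posop_Lp pA l2.
  apply: le_trans (lerD (lexx _) (bA _ l2)).
  rewrite -[X in _ <= X + _](nrm_abs p1 l1) -[X in _ <= _ + X](nrm_abs p1 l3).
  have l1' := inLp_abs p1 l1; have l3' := inLp_abs p1 l3.
  apply: le_trans (ler_nrmD p1 l1' l3').
  apply: (ler_nrm p1); [exact: inLpB|exact: inLpD|].
  apply: filterS (posopB p1 pA (lu n) lf) => x /(_ I) E.
  apply: le_trans (ler_norm _); rewrite [leRHS]addfx /= E !subfx /T !addfx.
  set u := iter n _ _.
  have -> : f x - (A f x + gh x) =
    - (A u x + gh x - f x) + (A u x - A f x) by ring.
  by apply: le_trans (ler_normD _ _) _; rewrite normrN.
have f0 : nrm (f - T f) = 0.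
  apply/eqP; rewrite eq_le nrm_ge0 andbT.
  have cv2 : (nrm (iter n.+1 T h - f) + C * nrm (iter n T h - f)) @[n --> \oo] --> (0:R).
    rewrite -(addr0 0); apply: cvgD.
      by have := cv; rewrite -(cvg_shiftS (fun n => nrm (iter n T h - f))); exact.
    by rewrite -(mulr0 C); apply: cvgM => //; exact: cvg_cst.
  rewrite -(cvg_lim _ cv2)//; apply: limr_ge; first by apply/cvg_ex; eexists; exact: cv2.
  exact: nearW.
apply: filterS (nrm_eq0 p1 (inLpB p1 lf lTf) f0) => x /(_ I) /eqP E _.
by apply/eqP; rewrite -subr_eq0.
Qed.

Lemma fixed_diff_iter f h n : inLp f -> inLp h -> f = T f %[ae mu] -> h = T h %[ae mu] ->
  f - h = iter n A (f - h) %[ae mu].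
Proof.
move=> lf lh Tf Th; have lfh := inLpB p1 lf lh.
elim: n => [|n IH]; first exact: nearW.
have E1 := posop_ae p1 pA lfh (posop_Lp (pn n) lfh) IH.
have E2 := posopB p1 pA lf lh.
apply: filterS3 (filterI Tf Th) E1 E2 => x [/(_ I) Tfx /(_ I) Thx] /(_ I) E1 /(_ I) E2 _.
by rewrite /= -E1 E2 !subfx Tfx Thx /T !addfx; ring.
Qed.

(** The difference of two fixed points of [T] is fixed by every [A^n], so its constant norm is the
    limit 0 given by [nrm_iter_cvg0]. *)
Lemma fixed_unique f h : r < 1 -> inLp f -> inLp h ->
  f = T f %[ae mu] -> h = T h %[ae mu] -> f = h %[ae mu].
Proof.
move=> r1 lf lh Tf Th; have lfh := inLpB p1 lf lh.
have cv := nrm_iter_cvg0 r1 lfh.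
have n0 : nrm (f - h) = 0.
  apply/esym; rewrite -(cvg_lim _ cv)//.
  rewrite (_ : (fun n => _) = cst (nrm (f - h))) ?lim_cst//.
  apply/funext => n; apply/esym/nrm_ae => //; first exact: posop_Lp.
  exact: fixed_diff_iter.
apply: filterS (nrm_eq0 p1 lfh n0) => x /(_ I) /eqP E _.
by apply/eqP; rewrite -subr_eq0.
Qed.

(** Split [T^n h - s = A^n h + (S n - s)]. *)
Lemma iterT_cvg s h : r < 1 -> inLp s -> nrm (S n - s) @[n --> \oo] --> (0:R) ->
  inLp h -> nrm (iter n T h - s) @[n --> \oo] --> (0:R).
Proof.
move=> r1 ls cs lh.
apply: (@squeeze_cvgr _ _ _ _ (cst 0) (fun n => nrm (iter n A h) + nrm (S n - s))).
- apply: nearW => n; rewrite nrm_ge0/=.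
  have l1 := posop_Lp (pn n) lh; have l2 := inLpB p1 (lS n) ls.
  apply: le_trans (ler_nrmD p1 l1 l2).
  rewrite addrA; rewrite (@nrm_ae _ _ _ mu p p1 _ (iter n A h + S n - s))//.
  + by apply: inLpB => //; exact: inLp_iterT.
  + by apply: inLpB => //; exact: inLpD.
  + by apply: filterS (iterTE n lh) => x /(_ I) E _; rewrite !subfx E.
- exact: cvg_cst.
- by rewrite -(addr0 0); apply: cvgD => //; exact: nrm_iter_cvg0.
Qed.

Lemma partial_sum_limit_ge s n : \forall x \ae mu,
  S n x @[n --> \oo] --> s x -> S n x <= s x.
Proof.
apply: nearW => x cs; rewrite -(cvg_lim _ cs)//; apply: nondecreasing_cvgn_le.
  exact: partial_sum_mono.
by apply/cvg_ex; eexists; exact: cs.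
Qed.

Section compact.
Variables (i : nat) (cA : compact_op mu p (iter i A)).

(* [f] may exceed the minimal solution [s], the limit of the partial sums, but
   only for [s] do the iterates [A^n s = s - S n] vanish. *)
Lemma fixed_spectral_radius_lt1 f : inLp f -> (\forall x \ae mu, 0 <= f x) ->
  f = T f %[ae mu] -> (\forall x \ae mu, exists n, 0 < iter n A gh x) -> r < 1.
Proof.
move=> lf f0 Tf irr.
have iTf n : iter n T f = f %[ae mu].
  elim: n => [|n IH]; first exact: nearW.
  have := posop_ae p1 pA (inLp_iterT n lf) lf IH.
  by apply: filterS2 Tf => x /(_ I) -> /(_ I) E _; rewrite /= /T !addfx E.
(* [f = T^n f = A^n f + S n] with [A^n f >= 0]. *)
have Sf n : \forall x \ae mu, S n x <= f x.
  have An0 : \forall x \ae mu, 0 <= iter n A f x.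
    by apply: filterS2 (iterA0 n) (posop_le p1 (pn n) (inLp0 mu p1) lf f0) => x ->.
  apply: filterS3 An0 (iTf n) (iterTE n lf) => x An0 /(_ I) <- /(_ I) ->.
  by rewrite addfx lerDr.
have [s [ls s0 Ss cs]] : exists s, [/\ inLp s, (forall x, 0 <= s x),
    (\forall x \ae mu, S n x @[n --> \oo] --> s x) &
    nrm (S n - s) @[n --> \oo] --> (0:R)].
  apply: (@partial_sum_cvg (nrm f)) => n; apply: (ler_nrm p1) => //.
  apply: filterS (Sf n) => x Sfx; rewrite ger0_norm ?partial_sum_ge0//.
  exact: le_trans (ler_norm _).
(* If [A^n gh x > 0], already [S n.+1 x] is positive. *)
have spos : \forall x \ae mu, 0 < s x.
  have ge : \forall x \ae mu, forall n, S n x @[n --> \oo] --> s x -> S n x <= s x.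
    by apply: ae_foralln => n; exact: partial_sum_limit_ge.
  apply: filterS3 irr Ss ge => x [n An] Ssx /(_ n.+1 Ssx); apply: lt_le_trans.
  by rewrite /S big_ord_recr/= addfx ltr_wpDl// partial_sum_ge0.
(* [S n = T^n 0], so [s] is the limit of an orbit of [T]. *)
have Ts : s = T s %[ae mu].
  apply: (T_limit_fixed (inLp0 mu p1) ls).
  rewrite (_ : (fun n => _) = fun n => nrm (S n - s))//.
  apply/funext => n; apply: nrm_ae => //.
  - by apply: inLpB => //; apply: inLp_iterT; exact: inLp0.
  - exact: inLpB.
  apply: filterS2 (iterTE n (inLp0 mu p1)) (iterA0 n) => x /(_ I) E E0 _.
  by rewrite !subfx E addfx E0 add0r.
(* [s = T^n s = A^n s + S n]. *)
have As n : nrm (iter n A s) = nrm (S n - s).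
  rewrite -(nrm_abs p1 (inLpB p1 (lS n) ls)); apply: nrm_ae => //.
  - exact: posop_Lp.
  - by apply: inLp_abs => //; exact: inLpB.
  have iTs : iter n T s = s %[ae mu].
    elim: n => [|n IH]; first exact: nearW.
    have := posop_ae p1 pA (inLp_iterT n ls) ls IH.
    by apply: filterS2 Ts => x /(_ I) -> /(_ I) E _; rewrite /= /T !addfx E.
  apply: filterS2 iTs (iterTE n ls) => x /(_ I) E1 /(_ I) E2 _.
  have -> : (S n - s) x = - iter n A s x.
    by rewrite subfx -[X in _ - X]E1 E2 addfx; ring.
  by rewrite normrN ger0_norm//; exact: (posop_ge0 (pn n)).
(* Strict positivity of [s] allows it as the comparison function; [e = 1/2] matches [growth_lt1]. *)
have [m Hm] := opn_compact p1 pA cA ls spos (e := 2^-1) ltac:(by rewrite invr_gt0).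
have cAs : nrm (iter n A s) @[n --> \oo] --> (0:R) by under eq_fun do rewrite As.
exact: (growth_lt1 iter_norm_ge0 iter_normM (ler0n _ m) cAs Hm).
Qed.

End compact.
End affine_dynamics.

(** * The local spectral radius *)

(** The exponent [p] cancels, leaving [ln (a n) / n] squeezed between values [ln t] with [t] on
    either side of [r]; when [r = 0] the upper bounds alone force the limit [-oo]. *)
Lemma root_test_cvg (R : realType) (p r : R) (a : nat -> R) : 0 < p -> 0 <= r ->
  (forall n, 0 <= a n) ->
  (forall t, r < t -> exists N, forall n, (N <= n)%N -> a n <= t ^+ n) ->
  (forall t, 0 < t -> t < r -> exists N, forall n, (N <= n)%N -> t ^+ n <= a n) ->
  (lne (a n `^ p)%:E * ((n%:R * p)^-1)%:E)%E @[n --> \oo] --> lne r%:E.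
Proof.
move=> p0 r0 a0 up low.
set w := fun n => _.
have wE n : (0 < n)%N -> 0 < a n -> w n = (ln (a n) / n%:R)%:E.
  move=> n0 an; rewrite /w lne_EFin ?powR_gt0// ln_powR -EFinM; congr _%:E.
  by rewrite invfM [p * _]mulrC -mulrA; congr (_ * _);
    rewrite mulrCA mulfV ?mulr1// gt_eqF.
have w_le n t : (0 < n)%N -> 0 < t -> a n <= t ^+ n -> (w n <= (ln t)%:E)%E.
  move=> n0 t0 an; have [a_eq0|a_neq0] := eqVneq (a n) 0.
    (* When [a n = 0] the term is [-oo], below any [ln t]. *)
    rewrite /w a_eq0 powR0 ?gt_eqF// le0_lneNy// gt0_mulNye ?leNye//.
    by rewrite lte_fin invr_gt0 mulr_gt0// ltr0n.
  have an0 : 0 < a n by rewrite lt_def a_neq0 a0.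
  rewrite wE// lee_fin ler_pdivrMr ?ltr0n// mulr_natr -lnXn//.
  by rewrite ler_ln// posrE exprn_gt0.
have w_ge n t : (0 < n)%N -> 0 < t -> t ^+ n <= a n -> ((ln t)%:E <= w n)%E.
  move=> n0 t0 an; have an0 : 0 < a n by apply: lt_le_trans an; rewrite exprn_gt0.
  rewrite wE// lee_fin ler_pdivlMr ?ltr0n// mulr_natr -lnXn//.
  by rewrite ler_ln// posrE exprn_gt0.
have [r_eq0|rn0] := eqVneq r 0.
  rewrite r_eq0 le0_lneNy//; apply/cvgeNyPle => M.
  have [|N HN] := up (expR M); first by rewrite r_eq0 expR_gt0.
  (* Index 0 is excluded: there [(n%:R * p)^-1] is the default inverse of 0. *)
  exists N.+1 => // n /= Nn; rewrite -[M]expRK; apply: w_le; rewrite ?expR_gt0//.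
    exact: leq_trans Nn.
  by apply: HN; exact: ltnW.
have rp : 0 < r by rewrite lt_def rn0.
rewrite lne_EFin//.
have B e : 0 < e -> \forall n \near \oo,
    ((ln r - e)%:E <= w n)%E /\ (w n <= (ln r + e)%:E)%E.
  move=> e0.
  have [|N1 H1] := up (r * expR e); first by rewrite ltr_pMr// expR_gt1.
  have [||N2 H2] := low (r * expR (- e)); first by rewrite mulr_gt0// expR_gt0.
    by rewrite gtr_pMr// expR_lt1 oppr_lt0.
  exists (maxn N1 N2).+1 => // n /=; rewrite gtn_max => /andP[n1 n2].
  have n0 : (0 < n)%N by exact: leq_trans n1.
  have -> : ln r - e = ln (r * expR (- e)) by rewrite lnM ?posrE ?expR_gt0// expRK.
  have -> : ln r + e = ln (r * expR e) by rewrite lnM ?posrE ?expR_gt0// expRK.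
  split; [apply: w_ge|apply: w_le] => //; rewrite ?mulr_gt0 ?expR_gt0//.
    by apply: H2; exact: ltnW.
  by apply: H1; exact: ltnW.
apply/fine_cvgP; split.
  apply: filterS (B 1 ltr01) => n [].
  by case: (w n) => // [|]; rewrite ?leeNy_eq ?leye_eq.
apply/cvgrPdist_le => e e0; apply: filterS (B e e0) => n [].
rewrite /=; case: (w n) => [z||] //=; rewrite ?lee_fin.
by move=> h1 h2; rewrite ler_norml; apply/andP; split; lra.
Qed.

Section stability.
Context (R : realType) (d : measure_display) (X : measurableType d).
Context (mu : probability X R) (p : R) (p1 : 1 <= p).
Variables (A : (X -> R) -> (X -> R)) (i : nat).
Hypotheses (pA : posop mu p A) (cA : compact_op mu p (iter i A)).
Local Notation nrm := (nrm mu p).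
Local Notation r := (spectral_radius mu p A).

Lemma spectral_radius_ge0 : 0 <= r.
Proof. exact: growth_ge0 (iter_norm_ge0 p1 pA) (iter_normM p1 pA). Qed.

(** Since [nrm (cst 1) = 1], the norm of [A^n 1] is at most the operator norm; conversely
    [opn_compact] with [s = 1] supplies the hypothesis [key] of [growth_lower]. *)
Lemma local_spectral_radius :
  (lne (nrm (iter n A (cst 1)) `^ p)%:E * ((n%:R * p)^-1)%:E)%E @[n --> \oo]
    --> lne r%:E.
Proof.
have l1 : inLp mu p (cst 1) by exact: inLp_cst.
have lA n : inLp mu p (iter n A (cst 1)) := posop_Lp (posop_iter p1 n pA) l1.
have ab n : nrm (iter n A (cst 1)) <= iter_norm mu p A n.
  by have := opn_le (posop_iter p1 n pA) l1; rewrite nrm_cst1 mulr1.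
apply: root_test_cvg.
- exact: lt_le_trans p1.
- exact: spectral_radius_ge0.
- by move=> n; exact: nrm_ge0.
- move=> t rt; have [N HN] := growth_upper (iter_norm_ge0 p1 pA) (iter_normM p1 pA) rt.
  by exists N => n Nn; exact: le_trans (ab n) (HN n Nn).
apply: (growth_lower (iter_norm_ge0 p1 pA) (iter_normM p1 pA) (i := i)).
- by move=> n; exact: nrm_ge0.
- move=> n k; rewrite addnC iterD.
  exact: opn_le (posop_iter p1 k pA) (lA n).
- move=> e e0; have s0 : \forall x \ae mu, 0 < (cst 1 : X -> R) x.
    by apply: nearW => x; exact: ltr01.
  exact: (opn_compact p1 pA cA l1 s0 e0).
Qed.

End stability.

(** * The valuation operator of the Markov model *)

Section null_integral.
Local Open Scope ereal_scope.

Lemma integral_eq0_ae (R : realType) d (T : measurableType d) (m : {measure set T -> \bar R})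
    (f : T -> \bar R) : measurable_fun setT f -> (forall x, 0 <= f x) ->
  \int[m]_x f x = 0 -> \forall x \ae m, f x = 0.
Proof.
move=> mf f0 if0; have : \int[m]_x `|f x| = 0.
  by under eq_integral do rewrite gee0_abs//.
by move/(ae_eq_integral_abs m measurableT mf); apply: filterS => x /(_ I).
Qed.

Lemma ae_integral_eq0 (R : realType) d (T : measurableType d) (m : {measure set T -> \bar R})
    (f : T -> \bar R) : measurable_fun setT f -> (\forall x \ae m, f x = 0) ->
  \int[m]_x f x = 0.
Proof.
move=> mf f0; rewrite (ae_eq_integral (cst 0)) ?integral_cst ?mul0e//.
by apply: filterS f0.
Qed.

End null_integral.

Section model.
Context (R : realType) (d1 d2 : measure_display).
Context (X : measurableType d1) (W : measurableType d2).
Variables (Pi : R.-pker X ~> X) (pi : probability X R) (nu : probability W R).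
Variables (phi g : X -> X -> W -> R) (p : R).
Hypothesis (mphi : measurable_fun [set: X * X * W] (fun z => phi z.1.1 z.1.2 z.2)).
Hypothesis (mg : measurable_fun [set: X * X * W] (fun z => g z.1.1 z.1.2 z.2)).
Hypothesis (phi_gt0 : forall x y e, 0 < phi x y e).
Hypothesis (g0 : forall x y e, 0 <= g x y e).
Local Open Scope ereal_scope.

Let phi0 x y e : (0 <= phi x y e)%R. Proof. exact: ltW. Qed.

(** Staying in the extended reals avoids the default values of [fine], so identities for nonnegative
    functions hold at every point; [iterVE] transfers them to [Vop]. *)
Definition UE (F : X -> \bar R) (x : X) : \bar R :=
  \int[Pi x]_y (F y * phibar nu phi x y).

Lemma measurable_int_nu (f : X -> X -> W -> R) :
  measurable_fun [set: X * X * W] (fun z => f z.1.1 z.1.2 z.2) ->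
  (forall x y e, (0 <= f x y e)%R) ->
  measurable_fun [set: X * X] (fun z => \int[nu]_e (f z.1 z.2 e)%:E).
Proof.
move=> mf f0.
apply: (@measurable_fun_fubini_tonelli_F _ _ _ _ R nu
  (fun z : (X * X) * W => (f z.1.1 z.1.2 z.2)%:E)).
  exact/measurable_EFinP.
by move=> x; rewrite lee_fin.
Qed.

Lemma measurable_phibar : measurable_fun [set: X * X] (fun z => phibar nu phi z.1 z.2).
Proof. exact: measurable_int_nu. Qed.

Lemma measurable_phi_section x y : measurable_fun setT (fun e => (phi x y e)%:E).
Proof.
apply/measurable_EFinP.
have := measurableT_comp mphi (measurable_pair1 (x, y)).
exact.
Qed.

(** If the integral of this positive function vanished, the function would be 0 almost everywhere,
    and the whole space would be null for the probability [nu]. *)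
Lemma phibar_gt0 x y : 0 < phibar nu phi x y.
Proof.
rewrite lt_def integral_ge0 ?andbT => [|e _]; last by rewrite lee_fin.
apply/eqP => H.
have := integral_eq0_ae (measurable_phi_section x y) (fun e => phi0 x y e) H.
move=> H0.
have : \forall e \ae nu, False.
  by apply: filterS H0 => e [] h; have := phi_gt0 x y e; rewrite h ltxx.
move=> [N [mN N0 HN]].
have : nu setT <= nu N by apply: le_measure; rewrite ?inE// => z _; exact: HN.
rewrite N0 probability_setT; by rewrite leNgt lte01.
Qed.

Lemma measurable_UE F : measurable_fun setT F -> (forall x, 0 <= F x) ->
  measurable_fun setT (UE F).
Proof.
move=> mF F0.
apply: (measurable_fun_integral_sfinite_kernel
  (fun z : X * X => F z.2 * phibar nu phi z.1 z.2)).
  by move=> z; rewrite mule_ge0// ltW// phibar_gt0.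
apply: emeasurable_funM; last exact: measurable_phibar.
exact: measurableT_comp.
Qed.

Lemma UE_ge0 F : (forall x, 0 <= F x) -> forall x, 0 <= UE F x.
Proof.
by move=> F0 x; apply: integral_ge0 => y _; rewrite mule_ge0// ltW// phibar_gt0.
Qed.

Lemma iterUE_ge0 n F : (forall x, 0 <= F x) -> forall x, 0 <= iter n UE F x.
Proof. by move=> F0; elim: n => //= n IH; exact: UE_ge0. Qed.

Lemma measurable_iterUE n F : measurable_fun setT F -> (forall x, 0 <= F x) ->
  measurable_fun setT (iter n UE F).
Proof.
move=> mF F0; elim: n => //= n IH; apply: measurable_UE => //.
exact: iterUE_ge0.
Qed.

Lemma measurable_UE_integrand F x : measurable_fun setT F ->
  measurable_fun setT (fun y => F y * phibar nu phi x y).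
Proof.
move=> mF; apply: emeasurable_funM => //.
have := measurableT_comp measurable_phibar (measurable_pair1 x).
exact.
Qed.

(** * Path-space expectations as iterates of the valuation operator *)

Section pathspace.

Lemma pathES n x F : pathE Pi nu n.+1 x F = \int[Pi x]_y \int[nu]_e
  pathE Pi nu n y (fun xs es => F (scons x xs) (scons e es)).
Proof. by []. Qed.

(** Restricting to paths that start at [x] is what allows [xs 0] to be replaced by the current state
    after one step is peeled off. *)
Lemma eq_pathE n x F F' :
  (forall xs es, xs 0%N = x -> F xs es = F' xs es) ->
  pathE Pi nu n x F = pathE Pi nu n x F'.
Proof.
elim: n x F F' => [|n IH] x F F' FF /=; first exact: FF.
apply: eq_integral => y _; apply: eq_integral => e _; apply: IH => xs es _.
exact: FF.
Qed.

Lemma prodPhi_scons n x e xs es :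
  prodPhi phi n.+1 (scons x xs) (scons e es) =
  (phi x (xs 0%N) e * prodPhi phi n xs es)%R.
Proof. by rewrite /prodPhi big_ord_recl. Qed.

(** The constant [c] makes the induction go through: the first factor [phi x y e] is absorbed into
    it before integrating over [e] and [y]. *)
Lemma pathE_prodPhi n x (c : R) : (0 <= c)%R ->
  pathE Pi nu n x (fun xs es => (c * prodPhi phi n xs es)%:E) =
  c%:E * iter n UE (cst 1) x.
Proof.
elim: n x c => [|n IH] x c c0.
  by rewrite /= /prodPhi big_ord0 mulr1 mule1.
have F0 y : 0 <= iter n UE (cst 1) y by exact: iterUE_ge0.
have mF : measurable_fun setT (iter n UE (cst 1)) by exact: measurable_iterUE.
rewrite pathES.
transitivity (\int[Pi x]_y (c%:E * (iter n UE (cst 1) y * phibar nu phi x y))).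
  apply: eq_integral => y _.
  transitivity (\int[nu]_e ((phi x y e)%:E * (c%:E * iter n UE (cst 1) y))).
    apply: eq_integral => e _.
    rewrite muleA -EFinM [(phi _ _ _ * c)%R]mulrC -IH ?mulr_ge0//.
    by apply: eq_pathE => xs es xs0; rewrite prodPhi_scons xs0 mulrA.
  rewrite ge0_integralZr//.
  - by rewrite muleC -muleA.
  - exact: measurable_phi_section.
  - by move=> e _; rewrite lee_fin.
  - by rewrite mule_ge0.
rewrite ge0_integralZl//.
- exact: measurable_UE_integrand.
- by move=> y _; rewrite mule_ge0// ltW// phibar_gt0.
Qed.

Lemma EprodPhiE n x : EprodPhi Pi nu phi n x = iter n UE (cst 1) x.
Proof.
rewrite -[RHS]mul1e -pathE_prodPhi//; apply: eq_pathE => xs es _.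
by rewrite mul1r.
Qed.

Let phig x y e := (phi x y e * g x y e)%R.

Let phig0 x y e : (0 <= phig x y e)%R. Proof. by rewrite mulr_ge0. Qed.

Let mphig : measurable_fun [set: X * X * W] (fun z => phig z.1.1 z.1.2 z.2).
Proof. exact: measurable_funM. Qed.

Lemma ghatE_ge0 x : 0 <= ghatE Pi nu phi g x.
Proof.
by apply: integral_ge0 => y _; apply: integral_ge0 => e _; rewrite lee_fin phig0.
Qed.

Lemma measurable_ghatE : measurable_fun setT (ghatE Pi nu phi g).
Proof.
apply: (measurable_fun_integral_sfinite_kernel
  (fun z : X * X => \int[nu]_e (phig z.1 z.2 e)%:E)).
  by move=> z; apply: integral_ge0 => e _; rewrite lee_fin.
exact: measurable_int_nu.
Qed.

Lemma measurable_phig_section x y : measurable_fun setT (fun e => (phig x y e)%:E).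
Proof.
apply/measurable_EFinP.
have := measurableT_comp mphig (measurable_pair1 (x, y)).
exact.
Qed.

Lemma measurable_int_phig x : measurable_fun setT (fun y => \int[nu]_e (phig x y e)%:E).
Proof.
have := measurableT_comp (measurable_int_nu mphig phig0) (measurable_pair1 x).
exact.
Qed.

(** Same induction as for [pathE_prodPhi]; the last transition, the only one carrying a payoff,
    contributes [ghatE] in the base case. *)
Lemma pathE_sol n x (c : R) : (0 <= c)%R ->
  pathE Pi nu n.+1 x (fun xs es =>
    (c * (prodPhi phi n.+1 xs es * g (xs n) (xs n.+1) (es n)))%:E) =
  c%:E * iter n UE (ghatE Pi nu phi g) x.
Proof.
elim: n x c => [|n IH] x c c0.
  rewrite /= /ghatE -ge0_integralZl//.
  - apply: eq_integral => y _; rewrite -ge0_integralZl//.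
    + by apply: eq_integral => e _; rewrite /prodPhi big_ord1/= EFinM.
    + exact: measurable_phig_section.
    + by move=> e _; rewrite lee_fin phig0.
  - exact: measurable_int_phig.
  - by move=> y _; apply: integral_ge0 => e _; rewrite lee_fin phig0.
have F0 y : 0 <= iter n UE (ghatE Pi nu phi g) y.
  by apply: iterUE_ge0; exact: ghatE_ge0.
have mF : measurable_fun setT (iter n UE (ghatE Pi nu phi g)).
  by apply: measurable_iterUE; [exact: measurable_ghatE|exact: ghatE_ge0].
rewrite pathES.
transitivity (\int[Pi x]_y (c%:E * (iter n UE (ghatE Pi nu phi g) y * phibar nu phi x y))).
  apply: eq_integral => y _.
  transitivity (\int[nu]_e ((phi x y e)%:E * (c%:E * iter n UE (ghatE Pi nu phi g) y))).
    apply: eq_integral => e _.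
    rewrite muleA -EFinM [(phi _ _ _ * c)%R]mulrC -IH ?mulr_ge0//.
    apply: eq_pathE => xs es xs0; rewrite prodPhi_scons xs0 /=.
    by rewrite !mulrA.
  rewrite ge0_integralZr//.
  - by rewrite muleC -muleA.
  - exact: measurable_phi_section.
  - by move=> e _; rewrite lee_fin.
  - by rewrite mule_ge0.
rewrite ge0_integralZl//.
- exact: measurable_UE_integrand.
- by move=> y _; rewrite mule_ge0// ltW// phibar_gt0.
Qed.

Lemma sol_termE n x : sol_term Pi nu phi g n.+1 x = iter n UE (ghatE Pi nu phi g) x.
Proof.
rewrite -[RHS]mul1e -pathE_sol//; apply: eq_pathE => xs es _.
by rewrite mul1r.
Qed.

Hypothesis A1pos : 0 < \int[pi]_x pathE Pi nu 1 x (fun xs es =>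
        (if (0 < g (xs 0%N) (xs 1%N) (es 0%N))%R then 1 else 0)%:E).

(** If [ghatE] vanished almost everywhere, [phi > 0] would force [g = 0] almost surely, against
    [A1pos]. *)
Lemma ghatE_pos : 0 < pi [set x | 0 < ghatE Pi nu phi g x].
Proof.
set B := [set x | _].
have mB : measurable B.
  rewrite -[B]setTI; apply: emeasurable_fun_o_infty => //; exact: measurable_ghatE.
rewrite lt_def measure_ge0 andbT; apply/eqP => B0.
move: A1pos; rewrite lt_def => /andP[/eqP + _]; apply.
pose J x y e : R := (if (0 < g x y e) then 1 else 0)%R.
have J0 x y e : (0 <= J x y e)%R by rewrite /J; case: ifP.
have mJ : measurable_fun [set: X * X * W] (fun z => J z.1.1 z.1.2 z.2).
  apply: measurable_fun_ifT => //; exact: measurable_fun_ltr.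
have mJ2 := measurable_int_nu mJ J0.
have mJy x : measurable_fun setT (fun y => \int[nu]_e (J x y e)%:E).
  have := measurableT_comp mJ2 (measurable_pair1 x); exact.
have mJe x y : measurable_fun setT (fun e => (J x y e)%:E).
  apply/measurable_EFinP.
  have := measurableT_comp mJ (measurable_pair1 (x, y)); exact.
apply: (@ae_integral_eq0 _ _ _ pi).
  apply: (measurable_fun_integral_sfinite_kernel
    (fun z : X * X => \int[nu]_e (J z.1 z.2 e)%:E)) => // z.
  by apply: integral_ge0 => e _; rewrite lee_fin.
exists B; split => // x; apply: contra_notP => /negP.
rewrite -leNgt => gx.
have {}gx : ghatE Pi nu phi g x = 0 by apply/eqP; rewrite eq_le gx ghatE_ge0.
apply: (@ae_integral_eq0 _ _ _ (Pi x)); first exact: mJy.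
have := integral_eq0_ae (measurable_int_phig x) _ gx.
have H y : 0 <= \int[nu]_e (phig x y e)%:E by apply: integral_ge0 => e _; rewrite lee_fin.
move=> /(_ H); apply: filterS => y gy.
apply: (@ae_integral_eq0 _ _ _ nu); first exact: mJe.
have := integral_eq0_ae (measurable_phig_section x y) (fun e => phig0 x y e) gy.
apply: filterS => e [] /eqP; rewrite /phig mulf_eq0 gt_eqF//= => /eqP ge0.
by rewrite /= ge0 ltxx.
Qed.

Lemma kpow_ge0 n x B : 0 <= kpow Pi n x B.
Proof.
elim: n x => [|n IH] x /=; first by rewrite lee_fin.
by apply: integral_ge0 => y _; exact: IH.
Qed.

Lemma measurable_kpow n B : measurable B -> measurable_fun setT (fun x => kpow Pi n x B).
Proof.
move=> mB; elim: n => [|n IH] /=.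
  by apply/measurable_EFinP; exact: measurable_indic.
apply: (measurable_fun_integral_sfinite_kernel (fun z : X * X => kpow Pi n z.2 B)).
  by move=> z; exact: kpow_ge0.
have := measurableT_comp IH (@measurable_snd _ _ X X); exact.
Qed.

(** As [phibar > 0], the weighted integral vanishes only if [iter n UE F] vanishes [Pi x]-almost
    everywhere, and by induction so does the [n]-step kernel. *)
Lemma iterUE_pos F n x : measurable_fun setT F -> (forall x, 0 <= F x) ->
  0 < kpow Pi n x [set x | 0 < F x] -> 0 < iter n UE F x.
Proof.
move=> mF F0; set B := [set x | _].
have mB : measurable B.
  by rewrite -[B]setTI; apply: emeasurable_fun_o_infty.
elim: n x => [|n IH] x /=.
  rewrite lte_fin indicE; case: (boolP (x \in B)) => [|_]; last by rewrite ltxx.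
  by rewrite inE.
move=> K; rewrite lt_def UE_ge0 ?andbT; last exact: iterUE_ge0.
apply/eqP => U0; move: K; apply/negP; rewrite -leNgt le_eqVlt; apply/orP; left.
apply/eqP/(@ae_integral_eq0 _ _ _ (Pi x)); first exact: measurable_kpow.
have := integral_eq0_ae (measurable_UE_integrand x (measurable_iterUE n mF F0)) _ U0.
have H y : 0 <= iter n UE F y * phibar nu phi x y.
  by rewrite mule_ge0 ?iterUE_ge0// ltW// phibar_gt0.
move=> /(_ H); apply: filterS => y /eqP; rewrite mule_eq0 [X in _ || X]gt_eqF ?phibar_gt0// orbF => /eqP y0.
apply/eqP; rewrite eq_le kpow_ge0 andbT leNgt; apply/negP => /IH.
by rewrite y0 ltxx.
Qed.

End pathspace.

Hypothesis st : stationary Pi pi.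

(** Integrating [Pi x N] over [pi] gives [pi N = 0] by stationarity. This makes [pi]-null sets
    invisible to [V]. *)
Lemma ae_kernel (P : X -> Prop) : (\forall y \ae pi, P y) ->
  \forall x \ae pi, \forall y \ae Pi x, P y.
Proof.
move=> [N [mN N0 PN]].
have := st mN; rewrite N0 => /integral_eq0_ae H.
have := H (measurable_kernel Pi N mN) (fun x => measure_ge0 _ _).
apply: filterS => x xN; exists N; split => //.
Qed.

Hypothesis p1 : (1 <= p)%R.
Hypothesis V_int : forall h, inLp pi p h ->
  (\forall x \ae pi, (Pi x).-integrable setT
                                (fun y => (h y)%:E * phibar nu phi x y))
         /\ inLp pi p (Vop Pi nu phi h).
Hypothesis V_bounded : exists C : R, forall h, inLp pi p h ->
         Lnorm pi p%:E (EFin \o Vop Pi nu phi h) <= C%:E * Lnorm pi p%:E (EFin \o h).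

Local Notation V := (Vop Pi nu phi).

Lemma V_ge0 h : (forall x, 0 <= h x)%R -> forall x, (0 <= V h x)%R.
Proof.
move=> h0 x; apply: fine_ge0; apply: integral_ge0 => y _.
by rewrite mule_ge0// ?lee_fin// ltW// phibar_gt0.
Qed.

Lemma V_posop : posop pi p V.
Proof.
split.
- by move=> f /V_int[].
(* The constant of the boundedness assumption carries no sign, hence the absolute value. *)
- have [C bC] := V_bounded; exists `|C|%R => // f lf.
  have := bC f lf; rewrite !nrmE//; last by have [] := V_int lf.
  rewrite -EFinM lee_fin => H; apply: le_trans H _.
  by rewrite ler_wpM2r ?nrm_ge0// ler_norm.
- move=> f f' lf lf'.
  have [i1 _] := V_int lf; have [i2 _] := V_int lf'.
  (* Integrability for the constant 1 makes [phibar nu phi x y] finite for [Pi x]-almost all [y], so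
     that the product distributes over the sum in the extended reals. *)
  have [i3 _] := V_int (inLp_cst pi p 1%R).
  have [i4 _] := V_int (inLpD p1 lf lf').
  apply: filterS2 (filterI i1 i2) (filterI i3 i4) => x [{}i1 {}i2] [{}i3 {}i4] _.
  rewrite addfx /Vop /VE.
  rewrite -fineD ?integrable_fin_num// -integralD//; congr fine.
  apply: ae_eq_integral => //.
  + exact: measurable_int i4.
  + by apply: emeasurable_funD; [exact: measurable_int i1|exact: measurable_int i2].
  apply: filterS (integrable_ae measurableT i3) => y /(_ I) + _.
  rewrite mul1e => /fineK <-.
  by rewrite addfx -!EFinM -EFinD mulrDl.
- move=> c f lf; have [i1 _] := V_int lf.
  apply: filterS i1 => x i1 _; rewrite scalefx /Vop /VE.
  rewrite -[c in RHS]/(fine c%:E) -fineM ?integrable_fin_num// -integralZl//; congr fine.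
  by apply: eq_integral => y _; rewrite scalefx EFinM muleA.
- exact: V_ge0.
Qed.

(** [ae_kernel] carries the induction hypothesis under the integral against [Pi x], and
    integrability makes [fine] exact. *)
Lemma iterVE n h F : inLp pi p h -> (forall x, 0 <= F x) -> measurable_fun setT F ->
  (\forall x \ae pi, F x = (h x)%:E) ->
  \forall x \ae pi, iter n UE F x = (iter n V h x)%:E.
Proof.
move=> lh F0 mF Fh; elim: n => //= n IH.
have ln : inLp pi p (iter n V h) := posop_Lp (posop_iter p1 n V_posop) lh.
have [i1 _] := V_int ln.
apply: filterS2 (ae_kernel IH) i1 => x E i1.
rewrite /Vop fineK; last exact: integrable_fin_num.
apply: ae_eq_integral => //.
- exact/measurable_UE_integrand/measurable_iterUE.
- by apply: measurable_UE_integrand; apply/measurable_EFinP; exact: inLp_meas ln.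
- by apply: filterS E => y -> _.
Qed.

End model.

(** * Stability exponent, existence, uniqueness and convergence *)

Theorem theorem1 (R : realType) (d1 d2 : measure_display)
  (X : measurableType d1) (W : measurableType d2)
  (Pi : R.-pker X ~> X) (pi : probability X R) (nu : probability W R)
  (phi g : X -> X -> W -> R) (p : R) :
  polish_borel R X -> polish_borel R W ->
  stationary Pi pi ->
  measurable_fun [set: X * X * W] (fun z => phi z.1.1 z.1.2 z.2) ->
  measurable_fun [set: X * X * W] (fun z => g z.1.1 z.1.2 z.2) ->
  (forall x y e, 0 <= phi x y e) -> (forall x y e, 0 <= g x y e) ->
  assumption_A1 Pi pi nu phi g ->
  assumption_A2 Pi pi ->
  assumption_A3 Pi pi nu phi g p ->
  let Lp := stab_seq Pi pi nu phi p in
  let T := Top Pi nu phi g in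
  let sol := markov_solution Pi pi nu phi g p in
  exists L : \bar R,
    Lp n @[n --> \oo] --> L /\
    (* (a) <-> (b) *)
    ((L < 0)%E <-> (exists h, sol h)) /\
    (* (a) <-> (c) *)
    ((L < 0)%E <-> (exists h, sol h /\ forall h', sol h' -> h' = h %[ae pi])) /\
    (* (a) <-> (d) *)
    ((L < 0)%E <-> (exists h f, inHp pi p h /\ inHp pi p f /\
                        Lp_cvg pi p (fun n => iter n T h) f)) /\
    (* (a) <-> (e) *)
    ((L < 0)%E <-> (exists hs, sol hs /\ (forall h', sol h' -> h' = hs %[ae pi]) /\
                        forall h, inHp pi p h -> Lp_cvg pi p (fun n => iter n T h) hs)) /\
    (* representation of the unique Markov solution *)
    ((L < 0)%E -> forall hs, sol hs ->
       \forall x \ae pi, ((hs x)%:E = \sum_(1 <= n <oo) sol_term Pi nu phi g n x)%E).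
Proof.
move=> _ _ st mphi mg _ g0 [phi_gt0 G_pos] irr [p1 [gfin [lgh _]] V_int V_bd [i cA]].
move=> Lp T sol.
pose V := Vop Pi nu phi; pose gh := ghat Pi nu phi g; pose gE := ghatE Pi nu phi g.
have gE0 : forall x, (0 <= gE x)%E by exact: (ghatE_ge0 Pi nu phi_gt0 g0).
have mgE : measurable_fun setT gE by exact: (measurable_ghatE Pi nu mphi mg phi_gt0 g0).
have gh0 x : 0 <= gh x by exact/fine_ge0/gE0.
have pV : posop pi p V by exact: (V_posop mphi phi_gt0 p1 V_int V_bd).
have iterV := iterVE mphi phi_gt0 st p1 V_int V_bd.
have gEfin : \forall x \ae pi, gE x = (gh x)%:E.
  by apply: filterS gfin => x gx; rewrite /gh /ghat fineK// ge0_fin_numE.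
have iterg : \forall x \ae pi, forall n, iter n (UE Pi nu phi) gE x = (iter n V gh x)%:E.
  by apply: ae_foralln => n; exact: iterV.
(* Irreducibility is applied to the set where [gE > 0], of positive [pi]-measure by [ghatE_pos]. *)
have pos : \forall x \ae pi, exists n, 0 < iter n V gh x.
  apply: filterS iterg => x gx.
  have mB : measurable [set x | (0 < gE x)%E].
    by rewrite -[X in measurable X]setTI; apply: emeasurable_fun_o_infty.
  have [n kn] := irr _ mB (ghatE_pos mphi mg phi_gt0 g0 G_pos) x.
  by exists n.+1; rewrite -lte_fin -gx; exact: (iterUE_pos nu mphi phi_gt0 mgE gE0 kn).
set r := spectral_radius pi p V.
have lp1 : inLp pi p (cst 1) by exact: inLp_cst.
exists (lne r%:E); split.
  (* The expected discount products are the iterates [V^n 1], so the integral is the [p]-th power of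
     a norm. *)
  have -> : Lp = fun n => (lne (nrm pi p (iter n V (cst 1)) `^ p)%:E * ((n%:R * p)^-1)%:E)%E.
    apply/funext => n; rewrite /Lp /stab_seq; congr (lne _ * _)%E.
    have ln : inLp pi p (iter n V (cst 1)) := posop_Lp (posop_iter p1 n pV) lp1.
    rewrite nrm_powE//; apply: ae_eq_integral => //.
    - apply: (@measurableT_comp _ _ _ _ _ _ (fun x => (x `^ p)%E)) => //.
        exact: measurable_poweR.
      rewrite (_ : EprodPhi Pi nu phi n = iter n (UE Pi nu phi) (cst 1%E)).
        exact: measurable_iterUE.
      by apply/funext => x; exact: EprodPhiE.
    - exact/measurable_abs_powR/(inLp_meas ln).
    - have := iterV n _ (cst 1%E) lp1 (fun=> lee01) (measurable_cst _).
      have c1 : \forall x \ae pi, (cst 1%E : X -> \bar R) x = ((cst 1 : X -> R) x)%:E.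
        exact: nearW.
      move=> /(_ c1); apply: filterS => x E _; rewrite EprodPhiE// E poweR_EFin ger0_norm//.
      by apply: (posop_ge0 (posop_iter p1 n pV)) => y; exact: ler01.
  exact: (local_spectral_radius p1 pV cA).
have rE : (lne r%:E < 0)%E <-> r < 1 by rewrite lne_lt0 lte_fin.
have lT h n : inLp pi p h -> inLp pi p (iter n T h) by exact: inLp_iterT.
(* Each of (b) to (e) yields some solution, so this one implication gives all the converses. *)
have sol_lt1 h : sol h -> r < 1.
  case=> -[lh h0] Th; exact: (fixed_spectral_radius_lt1 p1 pV lgh gh0 cA lh h0 Th pos).
(* All consequences of [r < 1] share the same witness, the limit [s] of the partial sums. *)
have lt1_sol : r < 1 -> exists s, [/\ sol s, (forall h, sol h -> h = s %[ae pi]),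
    (forall h, inHp pi p h -> Lp_cvg pi p (fun n => iter n T h) s) &
    \forall x \ae pi, (s x)%:E = (\sum_(1 <= n <oo) sol_term Pi nu phi g n x)%E].
  move=> r1; have [s [ls s0 Ss cs]] := partial_sum_cvg_lt1 p1 pV lgh gh0 r1.
  have cvs h : inLp pi p h -> nrm pi p (iter n T h - s) @[n --> \oo] --> (0:R).
    by move=> lh; exact: (iterT_cvg p1 pV lgh r1 ls cs lh).
  have Ts : s = T s %[ae pi] by exact: (T_limit_fixed p1 pV lgh (inLp0 pi p1) ls (cvs _ (inLp0 pi p1))).
  exists s; split.
  - by split => //; split => //; exact: nearW.
  - move=> h [[lh _] Th]; exact: (fixed_unique p1 pV r1 lh ls Th Ts).
  - by move=> h [lh _]; apply/(Lp_cvgE p1) => //; [move=> n; exact: lT|exact: cvs].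
  - apply: filterS2 iterg Ss => x gx Ssx.
    (* The series starts at 1 and [sol_term] at [n.+1] is the [n]-th iterate on [gE], hence the
       shift. *)
    apply/esym/cvg_lim => //; rewrite -cvg_shiftS /=.
    rewrite (_ : (fun n => _) = fun n => ((\sum_(k < n) iter k V gh) x)%:E).
      by apply: cvg_EFin; [exact: nearW|exact: Ssx].
    apply/funext => n; rewrite (sumfx (fun k => iter k V gh)) -sumEFin big_add1/=.
    by rewrite big_mkord; apply: eq_bigr => k _; rewrite sol_termE.
split; first by rewrite rE; split => [/lt1_sol[s []]|[h /sol_lt1]//]; exists s.
split.
  rewrite rE; split => [/lt1_sol[s [ss us _ _]]|[h [/sol_lt1]]//].
  by exists s; split.
split.
  rewrite rE; split => [/lt1_sol[s [ss us cs _]]|[h [f [hh [hf hf']]]]].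
    by exists s, s; have [hs _] := ss; split => //; split => //; exact: cs.
  have [[lh _] [lf _]] := (hh, hf).
  (* For (d), the limit of the iterates is itself a solution. *)
  apply: (sol_lt1 f); split => //.
  apply: (T_limit_fixed p1 pV lgh lh lf).
  by apply/(Lp_cvgE p1) => // n; exact: lT.
split.
  rewrite rE; split => [/lt1_sol[s [ss us cs _]]|[h [/sol_lt1]]//].
  by exists s; split => //; split.
rewrite rE => r1 h hsol; have [s [ss us _ Es]] := lt1_sol r1.
by apply: filterS2 Es (us h hsol) => x Es /(_ I) ->.
Qed.
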